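(* Let $R = (R, \mathfrak{m}, k)$ be a commutative local Noetherian ring. Then $$\operatorname{depth} R = \operatorname{findim} R = \operatorname{dell} R.$$ More precisely, when $R$ has depth $d$, the unit map $\eta_{d+1}$ of the adjunction $(\Sigma^{d+1}, \Omega^{d+1})$ on $\underline{\mathsf{mod}}\, R$, evaluated at $\Omega^d k$, is a stable equivalence $$\Omega^d k \xrightarrow{\ \simeq\ } \Omega^{d+1} \Sigma^{d+1} \Omega^d k,$$ and $d = \operatorname{depth} R$ is the lowest index for which this holds, i.e. the smallest $n \geq 0$ such that $\eta_{n+1} : \Omega^n k \to \Omega^{n+1}\Sigma^{n+1}\Omega^n k$ is a stable equivalence.
   Context: $\mathsf{mod}\, R$ denotes finitely presented $R$-modules. The stable category $\underline{\mathsf{mod}}\, R$ has the same objects, with morphisms the residue classes of homomorphisms modulo those factoring through projective objects. A stable equivalence is a morphism that is an isomorphism in $\underline{\mathsf{mod}}\, R$; a stable retract is a retract in $\underline{\mathsf{mod}}\, R$. The syzygy functor $\Omega : \underline{\mathsf{mod}}\, R \to \underline{\mathsf{mod}}\, R$ sends $M$ to $\ker(P \twoheadrightarrow M)$ for any epimorphism from a projective $P$ in $\mathsf{mod}\, R$. The Auslander–Bridger transpose $\mathrm{Tr}$ sends $M$ with presentation $P_1 \to P_0 \to M \to 0$ by finitely generated projectives to $\mathrm{coker}(P_0^* \to P_1^* )$, where $(-)^* = \mathrm{Hom}_R(-,R)$; it is a contravariant duality on stable categories. Put $\Sigma := \mathrm{Tr}\,\Omega\,\mathrm{Tr}$; by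 a result of Auslander–Reiten $\Sigma$ is left adjoint to $\Omega$ on $\underline{\mathsf{mod}}\, R$, hence $\Sigma^n$ is left adjoint to $\Omega^n$ for all $n \ge 0$, and $\eta_n : M \to \Omega^n\Sigma^n M$ denotes the unit. $\operatorname{depth} R = \inf\{ i \geq 0 \mid \mathrm{Ext}^i_R(k,R) \neq 0\}$. $\operatorname{findim} R$ is the supremum of $\operatorname{projdim} M$ over $M \in \mathsf{mod}\, R$ with $\operatorname{projdim} M < \infty$. For $M \in \mathsf{mod}\, R$, $\operatorname{dell} M := \inf\{ n \geq 0 \mid \Omega^n M \text{ is a stable retract of } \Omega^{n+1} N \text{ for some } N \in \underline{\mathsf{mod}}\, R\}$ ($\infty$ if no such $n$ exists), and $\operatorname{dell} R := \operatorname{dell} k$ (in general, the supremum over simple modules). *)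

(* Defs.v *)
From HB Require Import structures.
From mathcomp Require Import all_boot all_algebra.
From mathcomp Require Import boolp.

Set Implicit Arguments.
Unset Strict Implicit.
Unset Printing Implicit Defensive.

Import GRing.Theory.
Local Open Scope ring_scope.
Local Open Scope quotient_scope.

Section Linear.
Variable R : comNzRingType.
Implicit Types U V W : lmodType R.

Definition mklin U V (f : U -> V) (h : linear f) : {linear U -> V} :=
  HB.pack f (GRing.isLinear.Build R U V *:%R f h).

Definition lid U : {linear U -> U} := idfun.
Definition lcomp U V W (g : {linear V -> W}) (f : {linear U -> V}) :
  {linear U -> W} := g \o f.
Definition lmx a b (A : 'M[R]_(a, b)) : {linear 'rV[R]_a -> 'rV[R]_b} :=
  mulmxr A.

Definition kerp U V (f : {linear U -> V}) : {pred U} := fun x => f x == 0.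

Fact kerp_submod U V (f : {linear U -> V}) : submod_closed (kerp f).
Proof.
split=> [|a x y]; rewrite /kerp !unfold_in ?linear0 //.
by move=> /eqP hx /eqP hy; rewrite linearP hx hy scaler0 addr0.
Qed.
HB.instance Definition _ U V (f : {linear U -> V}) :=
  GRing.isSubmodClosed.Build R U (kerp f) (kerp_submod f).

Record kermod U V (f : {linear U -> V}) :=
  KerMod { kerval :> U; kervalP : kerval \in kerp f }.
HB.instance Definition _ U V (f : {linear U -> V}) := [isSub for @kerval U V f].
HB.instance Definition _ U V (f : {linear U -> V}) :=
  [Choice of kermod f by <:].
HB.instance Definition _ U V (f : {linear U -> V}) :=
  [SubChoice_isSubLmodule of kermod f by <:].

Definition imgp U V (f : {linear U -> V}) : {pred V} :=
  fun y => `[< exists x, f x = y >].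

Fact imgp_submod U V (f : {linear U -> V}) : submod_closed (imgp f).
Proof.
split=> [|a x y]; first by apply/asboolP; exists 0; rewrite linear0.
move=> /asboolP [u <-] /asboolP [v <-]; apply/asboolP.
by exists (a *: u + v); rewrite linearP.
Qed.
HB.instance Definition _ U V (f : {linear U -> V}) :=
  GRing.isSubmodClosed.Build R V (imgp f) (imgp_submod f).

End Linear.

Section Quotient.
Variables (R : comNzRingType) (V : lmodType R) (S : submodClosed V).
Fact submod_zmod_closed : zmod_closed S.
Proof. by split=> [|x y Sx Sy]; rewrite ?rpred0 // rpredD // -scaleN1r rpredZ. Qed.
Definition submod_zmod : zmodClosed V :=
  HB.pack (GRing.SubmodClosed.sort S) (GRing.isZmodClosed.Build V (GRing.SubmodClosed.sort S) submod_zmod_closed).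
Definition quotmod := Quotient.quot submod_zmod.
HB.instance Definition _ := GRing.Zmodule.on quotmod.
HB.instance Definition _ := EqQuotient.on quotmod.

Lemma quotE (x y : V) : \pi_quotmod x = \pi_quotmod y <-> x - y \in S.
Proof.
rewrite -[x - y \in S]/(x - y \in submod_zmod) Quotient.idealrBE.
by split=> [->|/eqP //]; rewrite eqxx.
Qed.
Lemma quotB x y : \pi_quotmod (x - y) = \pi_quotmod x - \pi_quotmod y.
Proof. by rewrite !piE. Qed.
Lemma quotD x y : \pi_quotmod (x + y) = \pi_quotmod x + \pi_quotmod y.
Proof. by rewrite !piE. Qed.

Lemma qK (v : quotmod) : \pi_quotmod (repr v) = v. Proof. exact: reprK. Qed.

Definition qscale (a : R) (x : quotmod) : quotmod := \pi_quotmod (a *: repr x).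
Lemma qscaleE a x : qscale a (\pi_quotmod x) = \pi_quotmod (a *: x).
Proof.
rewrite /qscale; apply/quotE; rewrite -scalerBr rpredZ //.
by apply/quotE; rewrite reprK.
Qed.
Fact qscaleA a b v : qscale a (qscale b v) = qscale (a * b) v.
Proof. by rewrite -[v]qK !qscaleE scalerA. Qed.
Fact qscale1 : left_id 1 qscale.
Proof. by move=> x; rewrite -[x]qK qscaleE scale1r. Qed.
Fact qscaleDr : right_distributive qscale +%R.
Proof.
move=> a; move=> x y; rewrite -[x]qK -[y]qK.
by rewrite -quotD !qscaleE scalerDr quotD.
Qed.
Fact qscaleDl v : {morph qscale^~ v : a b / a + b}.
Proof. by move=> a b /=; rewrite -[v]qK !qscaleE scalerDl quotD. Qed.
HB.instance Definition _ := GRing.Zmodule_isLmodule.Build R quotmod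
  qscaleA qscale1 qscaleDr qscaleDl.

Fact qpi_linear : linear (fun x : V => \pi_quotmod x).
Proof. by move=> a x y; rewrite quotD -qscaleE. Qed.
Definition qpi : {linear V -> quotmod} := mklin qpi_linear.
Lemma qpiP x : qpi x = 0 <-> x \in S.
Proof. by rewrite -(linear0 qpi) (quotE x 0) subr0. Qed.
Lemma qpi_surj y : exists x, qpi x = y.
Proof. by exists (repr y); rewrite /qpi /= reprK. Qed.
End Quotient.

Section FreeLifting.
Variable R : comNzRingType.
Implicit Types U V W : lmodType R.

Lemma row_ext a b (X Y : 'M[R]_(a, b)) :
  (forall x : 'rV_a, x *m X = x *m Y) -> X = Y.
Proof. by move=> h; apply/row_matrixP=> i; rewrite !rowE h. Qed.

Lemma free_lift a V W (q : {linear V -> W}) (f : {linear 'rV[R]_a -> W}) :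
  (forall y, exists x, q x = y) ->
  exists g : {linear 'rV[R]_a -> V}, forall x, q (g x) = f x.
Proof.
move=> qs; pose v i := projT1 (cid (qs (f (delta_mx 0 i)))).
have gl : linear (fun x : 'rV[R]_a => \sum_i x 0 i *: v i).
  move=> c x y; rewrite scaler_sumr -big_split; apply: eq_bigr => i _.
  by rewrite !mxE scalerDl scalerA.
exists (mklin gl) => x; rewrite /= linear_sum {2}(row_sum_delta x) linear_sum.
apply: eq_bigr => i _; rewrite !linearZ; congr (_ *: _).
exact: (projT2 (cid (qs (f (delta_mx 0 i))))).
Qed.

Lemma lin_as_mx a b (f : {linear 'rV[R]_a -> 'rV[R]_b}) :
  exists X, forall x, f x = x *m X.
Proof. by exists (lin1_mx f) => x; rewrite mul_rV_lin1. Qed.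

Lemma mx_lift a b W (q : {linear 'rV[R]_b -> W}) (f : {linear 'rV[R]_a -> W}) :
  (forall y, exists x, q x = y) ->
  exists X : 'M[R]_(a, b), forall x, q (x *m X) = f x.
Proof.
move=> qs; have [g hg] := free_lift f qs; have [X hX] := lin_as_mx g.
by exists X => x; rewrite -hX.
Qed.

Lemma mx_factor a b c (X : 'M[R]_(a, b)) (A : 'M[R]_(c, b)) :
  (forall x : 'rV_a, exists y : 'rV_c, x *m X = y *m A) ->
  exists Z, X = Z *m A.
Proof.
move=> h; exists (\matrix_i projT1 (cid (h (delta_mx 0 i)))).
apply/row_matrixP=> i; rewrite row_mul rowK -(projT2 (cid (h _))).
by rewrite rowE.
Qed.

End FreeLifting.

Section Presentations.
Variable R : comNzRingType.
Implicit Types U V W : lmodType R.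

Record presentation (M : lmodType R) := Presentation {
  pgens : nat;
  prels : nat;
  pcov : {linear 'rV[R]_pgens -> M};
  pmx : 'M[R]_(prels, pgens);
  pcov_surj : forall y, exists x, pcov x = y;
  pcov_ker : forall x, pcov x = 0 <-> exists y, x = y *m pmx }.

Definition finitely_presented (M : lmodType R) : Prop :=
  exists _ : presentation M, True.

Lemma pres_factor M (p : presentation M) a (X : 'M_(a, pgens p)) :
  (forall x, pcov p (x *m X) = 0) -> exists Z, X = Z *m pmx p.
Proof. by move=> h; apply: mx_factor => x; apply/pcov_ker/h. Qed.

Lemma pres_desc M (p : presentation M) W (f : {linear 'rV[R]_(pgens p) -> W}) :
  (forall y, f (y *m pmx p) = 0) ->
  exists g : {linear M -> W}, forall x, g (pcov p x) = f x.
Proof.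
move=> h; pose s y := projT1 (cid (pcov_surj p y)).
have sE y : pcov p (s y) = y by exact: (projT2 (cid (pcov_surj p y))).
have fE x y : pcov p x = pcov p y -> f x = f y.
  move=> e; apply/eqP; rewrite -subr_eq0 -linearB; apply/eqP.
  have /pcov_ker [z ->] : pcov p (x - y) = 0 by rewrite linearB e subrr.
  exact: h.
have gl : linear (f \o s).
  by move=> c x y; rewrite /= -linearP; apply: fE; rewrite linearP !sE.
by exists (mklin gl) => x; apply: fE; rewrite sE.
Qed.

Lemma pres_desc_mx M (p : presentation M) k (X : 'M[R]_(pgens p, k)) :
  pmx p *m X = 0 ->
  exists g : {linear M -> 'rV[R]_k}, forall x, g (pcov p x) = x *m X.
Proof.
move=> h; have [|g hg] := @pres_desc M p _ (lmx X).
  by move=> y; rewrite /= -mulmxA h mulmx0.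
by exists g.
Qed.

Record fpmod := FpMod {
  fp_sort :> lmodType R;
  fp_prop : finitely_presented fp_sort }.

(* Every M has the chosen presentation
   'rV_(rels M) --rel_mx M--> 'rV_(gens M) --cov M--> M --> 0,
   matrices acting on row vectors from the right. *)
Definition pres (M : fpmod) : presentation M := projT1 (cid (fp_prop M)).
Definition gens (M : fpmod) := pgens (pres M).
Definition rels (M : fpmod) := prels (pres M).
Definition cov (M : fpmod) : {linear 'rV[R]_(gens M) -> M} := pcov (pres M).
Definition rel_mx (M : fpmod) : 'M[R]_(rels M, gens M) := pmx (pres M).

Lemma cov_surj (M : fpmod) y : exists x, cov M x = y.
Proof. exact: pcov_surj. Qed.
Lemma cov_rel (M : fpmod) a (y : 'M_(a, _)) (x : 'rV_a) :
  cov M (x *m (y *m rel_mx M)) = 0.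
Proof. by apply/pcov_ker; exists (x *m y); rewrite mulmxA. Qed.
Lemma cov_rel0 (M : fpmod) y : cov M (y *m rel_mx M) = 0.
Proof. by apply/pcov_ker; exists y. Qed.
Lemma cov_factor (M : fpmod) a (X : 'M_(a, gens M)) :
  (forall x, cov M (x *m X) = 0) -> exists Z, X = Z *m rel_mx M.
Proof. exact: pres_factor. Qed.

Definition projective (P : lmodType R) : Prop :=
  forall (X Y : lmodType R) (q : {linear X -> Y}) (f : {linear P -> Y}),
    (forall y, exists x, q x = y) ->
    exists g : {linear P -> X}, forall z, q (g z) = f z.

Lemma free_projective n : projective 'rV[R]_n.
Proof. by move=> X Y q f; apply: free_lift. Qed.

Lemma free_fp n : finitely_presented 'rV[R]_n.
Proof.
unshelve eexists; last by [].
apply: (@Presentation _ n 0 (lid _) 0) => [y|x]; first by exists y.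
by split=> [/= ->|[y ->]]; [exists 0; rewrite mulmx0|rewrite mulmx0].
Qed.
Definition free_fpmod n := FpMod (free_fp n).

Implicit Types M N K : fpmod.

(* A morphism M -> N of the stable category is a linear map up to [stable_eq];
   functors and natural transformations below are those of the stable category,
   with [stable_eq] as equality of morphisms. *)
Definition stable_eq M N (f g : {linear M -> N}) : Prop :=
  exists (P : fpmod) (a : {linear M -> P}) (b : {linear P -> N}),
    projective P /\ forall x, f x - g x = b (a x).

Lemma stable_eqF M N (f g : {linear M -> N}) k (a : {linear M -> 'rV[R]_k})
    (b : {linear 'rV[R]_k -> N}) :
  (forall x, f x - g x = b (a x)) -> stable_eq f g.
Proof. by move=> h; exists (free_fpmod k), a, b; split=> //; apply: free_projective. Qed.

Lemma stable_eqX M N (f g : {linear M -> N}) k (X : 'M_(gens M, k))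
    (b : {linear 'rV[R]_k -> N}) :
  rel_mx M *m X = 0 ->
  (forall x, f (cov M x) - g (cov M x) = b (x *m X)) -> stable_eq f g.
Proof.
move=> hX h; have [a ha] := pres_desc_mx hX; apply: (@stable_eqF _ _ _ _ k a b).
by move=> y; have [x <-] := cov_surj y; rewrite h ha.
Qed.

Lemma stable_eqE M N (f g : {linear M -> N}) : stable_eq f g ->
  exists2 H : 'M_(gens M, gens N), rel_mx M *m H = 0 &
    forall x, f (cov M x) - g (cov M x) = cov N (x *m H).
Proof.
move=> [P [a [b [Pp h]]]]; have [c hc] := Pp _ _ _ b (@cov_surj N).
have [H hH] := lin_as_mx (lcomp c (lcomp a (cov M))); exists H.
  by apply: row_ext => x; rewrite mulmxA -hH /= cov_rel0 !linear0.
by move=> x; rewrite -hH /= hc h.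
Qed.

Lemma stable_refl M N (f : {linear M -> N}) : stable_eq f f.
Proof.
apply: (@stable_eqX _ _ _ _ 0 0 \0) => [|x]; first by rewrite mulmx0.
by rewrite subrr.
Qed.

Lemma stable_ext M N (f g : {linear M -> N}) : f =1 g -> stable_eq f g.
Proof.
move=> h; apply: (@stable_eqX _ _ _ _ 0 0 \0) => [|x]; first by rewrite mulmx0.
by rewrite h subrr.
Qed.

Lemma stable_sym M N (f g : {linear M -> N}) : stable_eq f g -> stable_eq g f.
Proof.
move=> /stable_eqE [H h0 h].
apply: (@stable_eqX _ _ _ _ _ (- H) (cov N)) => [|x]; first by rewrite mulmxN h0 oppr0.
by rewrite mulmxN linearN -h opprB.
Qed.

Lemma stable_trans M N (f g h : {linear M -> N}) :
  stable_eq f g -> stable_eq g h -> stable_eq f h.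
Proof.
move=> /stable_eqE [H h0 hH] /stable_eqE [K k0 hK].
apply: (@stable_eqX _ _ _ _ _ (H + K) (cov N)) => [|x].
  by rewrite mulmxDr h0 k0 addr0.
by rewrite mulmxDr linearD -hH -hK addrA subrK.
Qed.

Lemma stable_compl M N K (g g' : {linear N -> K}) (f : {linear M -> N}) :
  stable_eq g g' -> stable_eq (lcomp g f) (lcomp g' f).
Proof.
move=> [P [a [b [Pp h]]]]; exists P, (lcomp a f), b; split=> // x.
exact: h.
Qed.

Lemma stable_compr M N K (g : {linear N -> K}) (f f' : {linear M -> N}) :
  stable_eq f f' -> stable_eq (lcomp g f) (lcomp g f').
Proof.
move=> [P [a [b [Pp h]]]]; exists P, a, (lcomp g b); split=> // x.
by rewrite /= -linearB h.
Qed.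

Definition stable_equivalence M N (f : {linear M -> N}) : Prop :=
  exists g : {linear N -> M},
    stable_eq (lcomp g f) (lid M) /\ stable_eq (lcomp f g) (lid N).

Definition stable_retract M N : Prop :=
  exists (i : {linear M -> N}) (r : {linear N -> M}),
    stable_eq (lcomp r i) (lid M).

Record stfunctor := StFunctor {
  fob :> fpmod -> fpmod;
  fmap : forall M N, {linear M -> N} -> {linear fob M -> fob N};
  fmap_eq : forall M N (f g : {linear M -> N}),
    stable_eq f g -> stable_eq (fmap f) (fmap g);
  fmap_id : forall M, stable_eq (fmap (lid M)) (lid (fob M));
  fmap_comp : forall M N K (g : {linear N -> K}) (f : {linear M -> N}),
    stable_eq (fmap (lcomp g f)) (lcomp (fmap g) (fmap f)) }.

Record stcofunctor := StCofunctor {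
  cob :> fpmod -> fpmod;
  cmap : forall M N, {linear M -> N} -> {linear cob N -> cob M};
  cmap_eq : forall M N (f g : {linear M -> N}),
    stable_eq f g -> stable_eq (cmap f) (cmap g);
  cmap_id : forall M, stable_eq (cmap (lid M)) (lid (cob M));
  cmap_comp : forall M N K (g : {linear N -> K}) (f : {linear M -> N}),
    stable_eq (cmap (lcomp g f)) (lcomp (cmap f) (cmap g)) }.

Definition fid : stfunctor.
Proof.
apply: (@StFunctor id (fun M N f => f)) => // *; exact: stable_refl.
Defined.

Definition fcomp (G F : stfunctor) : stfunctor.
Proof.
apply: (@StFunctor (fun M => G (F M)) (fun M N f => fmap G (fmap F f))).
- by move=> M N f g h; do 2!apply: fmap_eq.
- by move=> M; apply: stable_trans (fmap_id _ _); apply/fmap_eq/fmap_id.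
- by move=> M N K g f; apply: stable_trans (fmap_comp _ _ _); apply/fmap_eq/fmap_comp.
Defined.

Definition fsandwich (D : stcofunctor) (F : stfunctor) : stfunctor.
Proof.
apply: (@StFunctor (fun M => D (F (D M))) (fun M N f => cmap D (fmap F (cmap D f)))).
- by move=> M N f g h; apply/cmap_eq/fmap_eq/cmap_eq.
- move=> M; apply: stable_trans (cmap_id _ _); apply: cmap_eq.
  by apply: stable_trans (fmap_id _ _); apply/fmap_eq/cmap_id.
- move=> M N K g f; apply: stable_trans (cmap_comp _ _ _); apply: cmap_eq.
  by apply: stable_trans (fmap_comp _ _ _); apply/fmap_eq/cmap_comp.
Defined.

(* F is left adjoint to G: each [adj_unit M] is a universal arrow from M to G, so
   that g |-> G g \o adj_unit M is a bijection Hom(F M, N) -> Hom(M, G N) between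
   stable Hom sets, natural in M and N, and [adj_unit] is the unit. *)
Record adjunction (F G : stfunctor) := Adjunction {
  adj_unit : forall M, {linear M -> G (F M)};
  adj_unit_nat : forall M N (f : {linear M -> N}),
    stable_eq (lcomp (fmap G (fmap F f)) (adj_unit M)) (lcomp (adj_unit N) f);
  adj_unit_ex : forall M N (f : {linear M -> G N}),
    exists g : {linear F M -> N}, stable_eq (lcomp (fmap G g) (adj_unit M)) f;
  adj_unit_inj : forall M N (g g' : {linear F M -> N}),
    stable_eq (lcomp (fmap G g) (adj_unit M)) (lcomp (fmap G g') (adj_unit M)) ->
    stable_eq g g' }.

Definition adj_id : adjunction fid fid.
Proof.
apply: (@Adjunction fid fid (fun M => lid M)).
- by move=> M N f; apply: stable_ext.
- by move=> M N f; exists f; apply: stable_ext.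
- move=> M N g g' h; apply: stable_trans (stable_trans _ h) _; exact: stable_ext.
Defined.

Definition adj_comp (F F' G G' : stfunctor) (a : adjunction F G)
    (a' : adjunction F' G') : adjunction (fcomp F' F) (fcomp G G').
Proof.
apply: (@Adjunction (fcomp F' F) (fcomp G G')
         (fun M => lcomp (fmap G (adj_unit a' (F M))) (adj_unit a M))).
- move=> M N f /=.
  apply: (@stable_trans _ _ _
     (lcomp (fmap G (lcomp (fmap G' (fmap F' (fmap F f))) (adj_unit a' (F M)))) (adj_unit a M))).
    apply: stable_trans (stable_compl _ (stable_sym (fmap_comp _ _ _))).
    exact: stable_ext.
  apply: (@stable_trans _ _ _
     (lcomp (fmap G (lcomp (adj_unit a' (F N)) (fmap F f))) (adj_unit a M))).
    by apply/stable_compl/fmap_eq/adj_unit_nat.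
  apply: stable_trans (stable_compl _ (fmap_comp _ _ _)) _.
  apply: (@stable_trans _ _ _
     (lcomp (fmap G (adj_unit a' (F N))) (lcomp (fmap G (fmap F f)) (adj_unit a M)))).
    exact: stable_ext.
  apply: stable_trans (stable_compr _ (adj_unit_nat _ _)) _; exact: stable_ext.
- move=> M N f; have [g hg] := adj_unit_ex a f; have [h hh] := adj_unit_ex a' g.
  exists h; apply: stable_trans _ hg.
  apply: stable_trans _ (stable_compl _ (fmap_eq G hh)).
  apply: stable_trans _ (stable_compl _ (stable_sym (fmap_comp _ _ _))).
  exact: stable_ext.
- move=> M N g g' h; apply: (adj_unit_inj (a := a')); apply: (adj_unit_inj (a := a)).
  apply: stable_trans (stable_compl _ (fmap_comp _ _ _)) _.
  apply: stable_trans _ (stable_compl _ (stable_sym (fmap_comp _ _ _))).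
  apply: stable_trans (stable_trans _ h) _; exact: stable_ext.
Defined.

(* Both are the n-th iterate of F (see fpowE and fpowrE). The two bracketings are
   needed because composition of adjunctions reverses the order of the factors. *)
Fixpoint fpow (F : stfunctor) n : stfunctor :=
  if n is n'.+1 then fcomp F (fpow F n') else fid.
Fixpoint fpowr (F : stfunctor) n : stfunctor :=
  if n is n'.+1 then fcomp (fpowr F n') F else fid.

Lemma fpowE F n M : fpow F n M = iter n F M.
Proof. by elim: n => //= n ->. Qed.
Lemma fpowrE F n M : fpowr F n M = iter n F M.
Proof. by elim: n M => //= n IH M; rewrite IH -iterSr. Qed.

Fixpoint adj_pow F G (a : adjunction F G) n : adjunction (fpow F n) (fpowr G n) :=
  if n is n'.+1 then adj_comp (adj_pow a n') a else adj_id.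

End Presentations.

Section Kernels.
Variable R : comNzRingType.
Implicit Types U V W : lmodType R.

Fact kincl_linear U V (f : {linear U -> V}) : linear (@kerval _ _ _ f).
Proof. by []. Qed.
Definition kincl U V (f : {linear U -> V}) : {linear kermod f -> U} :=
  mklin (@kincl_linear U V f).

Lemma kinclP U V (f : {linear U -> V}) (x : kermod f) : f (kincl f x) = 0.
Proof. by apply/eqP; exact: (kervalP x). Qed.

Lemma kincl_inj U V (f : {linear U -> V}) (x y : kermod f) :
  kincl f x = kincl f y -> x = y.
Proof. exact: val_inj. Qed.

Lemma ker_lift U V W (f : {linear U -> V}) (h : {linear W -> U}) :
  (forall x, f (h x) = 0) ->
  exists g : {linear W -> kermod f}, forall x, kincl f (g x) = h x.
Proof.
move=> hf; have kP x : h x \in kerp f by apply/eqP/hf.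
have gl : linear (fun x => KerMod (kP x)).
  by move=> a x y; apply: val_inj; rewrite /= linearP.
by exists (mklin gl).
Qed.

Definition noetherian : Prop :=
  forall I : submodClosed R^o, exists n (g : 'I_n -> R),
    forall x, x \in I <-> exists c : 'I_n -> R, x = \sum_i c i * g i.

Lemma noetherian_submod n (P : 'rV[R]_n -> Prop) : noetherian ->
  P 0 -> (forall a x y, P x -> P y -> P (a *: x + y)) ->
  exists c (E : 'M[R]_(c, n)), forall x, P x <-> exists y, x = y *m E.
Proof.
move=> noethR; elim: n P => [|n IH] P P0 PD.
  exists 0, 0 => x; rewrite (thinmx0 x).
  by split=> // _; exists 0; rewrite mulmx0.
pose I (r : R^o) := `[< exists2 x : 'rV[R]_n.+1, P x & x 0 0 = r >].
have I_sub : submod_closed (I : {pred R^o}).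
  split=> [|a r s]; first by apply/asboolP; exists 0; rewrite ?mxE.
  move=> /asboolP[x Px <-] /asboolP[y Py <-]; apply/asboolP.
  by exists (a *: x + y); [exact: PD|rewrite !mxE].
pose I' : submodClosed R^o := HB.pack I (GRing.isSubmodClosed.Build R R^o I I_sub).
have [b [g hg]] := noethR I'.
have gI i : exists2 x : 'rV[R]_n.+1, P x & x 0 0 = g i.
  apply/asboolP; apply/(hg (g i)); exists (fun j => (j == i)%:R).
  rewrite (bigD1 i) //= eqxx mul1r big1 ?addr0 // => j /negPf ->.
  by rewrite mul0r.
pose w i := s2val (cid2 (gI i)).
have Pw i : P (w i) by exact: (s2valP (cid2 (gI i))).
have w0 i : w i 0 0 = g i by exact: (s2valP' (cid2 (gI i))).
pose E1 : 'M[R]_(b, 1 + n) := \matrix_i w i.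
have PE1 y : P (y *m E1).
  rewrite mulmx_sum_row; elim/big_rec: _ => // i x _ Px; apply: PD => //.
  by rewrite rowK.
have PB x y : P x -> P y -> P (x - y).
  by move=> Px Py; rewrite addrC -scaleN1r; apply: PD.
pose P' (y : 'rV[R]_n) := P (row_mx (0 : 'rV_1) y).
have [||c [E2 hE2]] := IH P'.
- by rewrite /P' row_mx0.
- move=> a x y Px Py; rewrite /P'.
  rewrite (_ : row_mx _ _ = a *: row_mx (0 : 'rV_1) x + row_mx 0 y); first exact: PD.
  by rewrite scale_row_mx add_row_mx scaler0 addr0.
pose F2 : 'M[R]_(c, 1 + n) := row_mx (0 : 'M_(c, 1)) E2.
have F2E (y : 'rV_c) : y *m F2 = row_mx (0 : 'rV_1) (y *m E2).
  by rewrite /F2 mul_mx_row mulmx0.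
exists (b + c)%N, (col_mx E1 F2) => x; split; last first.
  case=> y ->; rewrite -[y]hsubmxK mul_row_col F2E.
  rewrite -[X in P (X + _)]scale1r; apply: PD => //.
  by apply/hE2; exists (rsubmx y).
move=> Px; have /hg [d hd] : x 0 0 \in I' by apply/asboolP; exists x.
pose y1 : 'rV[R]_b := \row_i d i.
have x'E : lsubmx (x - y1 *m E1 : 'rV_(1 + n)) = 0.
  apply/matrixP=> i j; rewrite !ord1 !mxE.
  rewrite (_ : lshift n 0 = 0); last exact: val_inj.
  rewrite hd; apply/eqP; rewrite subr_eq0; apply/eqP; apply: eq_bigr => k _.
  by rewrite !mxE w0.
have /hE2 [y2 hy2] : P' (rsubmx (x - y1 *m E1 : 'rV_(1 + n))).
  by rewrite /P' -x'E hsubmxK; apply: PB.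
exists (row_mx y1 y2); rewrite mul_row_col F2E -hy2 -x'E.
by rewrite (@hsubmxK _ 1 1 n) addrC subrK.
Qed.

Lemma ker_fp n V (f : {linear 'rV[R]_n -> V}) : noetherian ->
  finitely_presented (kermod f).
Proof.
move=> noethR.
have [||c [E hE]] := @noetherian_submod n (fun x => f x = 0) noethR.
- by rewrite linear0.
- by move=> a x y hx hy; rewrite linearP hx hy scaler0 addr0.
have [||d [C hC]] := @noetherian_submod c (fun x => x *m E = 0) noethR.
- by rewrite mul0mx.
- by move=> a x y hx hy; rewrite mulmxDl -scalemxAl hx hy scaler0 addr0.
have [|g hg] := @ker_lift _ _ _ f (lmx E).
  by move=> x; apply/hE; exists x.
unshelve eexists; last by [].
apply: (@Presentation _ _ c d g C) => [y|x].
  have /hE [x hx] := kinclP y; exists x; apply: kincl_inj; by rewrite hg.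
split=> [e|/hC e].
  by apply/hC; rewrite -[LHS]/(lmx E x) -hg e linear0.
by apply: kincl_inj; rewrite hg linear0.
Qed.

End Kernels.

Section Functors.
Variable R : comNzRingType.
Hypothesis noethR : noetherian R.
Implicit Types M N : fpmod R.

Lemma lift_ex M N (f : {linear M -> N}) : exists X : 'M[R]_(gens M, gens N),
  forall x, cov N (x *m X) = f (cov M x).
Proof. exact: (mx_lift (lcomp f (cov M)) (@cov_surj _ N)). Qed.
Definition lift_mx M N (f : {linear M -> N}) := projT1 (cid (lift_ex f)).
Lemma lift_mxE M N (f : {linear M -> N}) x :
  cov N (x *m lift_mx f) = f (cov M x).
Proof. exact: (projT2 (cid (lift_ex f))). Qed.

Lemma rel_lift_ex M N (f : {linear M -> N}) : exists X : 'M[R]_(rels M, rels N),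
  rel_mx M *m lift_mx f = X *m rel_mx N.
Proof.
by apply: cov_factor => x; rewrite mulmxA lift_mxE cov_rel0 linear0.
Qed.
Definition rel_lift M N (f : {linear M -> N}) := projT1 (cid (rel_lift_ex f)).
Lemma rel_liftE M N (f : {linear M -> N}) :
  rel_mx M *m lift_mx f = rel_lift f *m rel_mx N.
Proof. exact: (projT2 (cid (rel_lift_ex f))). Qed.

Lemma lift_htpy M N (f g : {linear M -> N}) (P Q : 'M_(gens M, gens N)) :
  (forall x, cov N (x *m P) = f (cov M x)) ->
  (forall x, cov N (x *m Q) = g (cov M x)) ->
  stable_eq f g ->
  exists H K, rel_mx M *m H = 0 /\ P - Q = H + K *m rel_mx N.
Proof.
move=> hP hQ /stable_eqE [H h0 hH]; exists H.
have [x|K hK] := @cov_factor _ N _ (P - Q - H).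
  by rewrite mulmxBr linearB mulmxBr linearB hP hQ hH subrr.
by exists K; split=> //; rewrite -hK [RHS]addrC subrK.
Qed.

Definition syz M : fpmod R := FpMod (ker_fp (cov M) noethR).

Lemma syz_map_ex M N (f : {linear M -> N}) : exists g : {linear syz M -> syz N},
  forall x, kincl (cov N) (g x) = kincl (cov M) x *m lift_mx f.
Proof.
by apply: (@ker_lift _ _ _ _ (cov N) (lcomp (lmx (lift_mx f)) (kincl (cov M)))) => x;
  rewrite /= lift_mxE kinclP linear0.
Qed.
Definition syz_map M N (f : {linear M -> N}) := projT1 (cid (syz_map_ex f)).
Lemma syz_mapE M N (f : {linear M -> N}) x :
  kincl (cov N) (syz_map f x) = kincl (cov M) x *m lift_mx f.
Proof. exact: (projT2 (cid (syz_map_ex f))). Qed.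

Lemma to_syz N k (B : 'M[R]_(k, gens N)) : (forall x, cov N (x *m B) = 0) ->
  exists b : {linear 'rV[R]_k -> syz N}, forall x, kincl (cov N) (b x) = x *m B.
Proof. exact: (@ker_lift _ _ _ _ (cov N) (lmx B)). Qed.

Lemma syz_eqI M N (u v : {linear syz M -> syz N}) (P Q : 'M_(gens M, gens N)) H (K : 'M_(gens M, rels N)) :
  (forall x, kincl (cov N) (u x) = kincl (cov M) x *m P) ->
  (forall x, kincl (cov N) (v x) = kincl (cov M) x *m Q) ->
  rel_mx M *m H = 0 -> P - Q = H + K *m rel_mx N -> stable_eq u v.
Proof.
move=> hu hv h0 e.
have [b hb] := @to_syz N _ (rel_mx N) (@cov_rel0 _ N).
apply: (@stable_eqF _ (syz M) (syz N) u v _ (lcomp (lmx K) (kincl (cov M))) b) => x.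
apply: kincl_inj; rewrite linearB hu hv -mulmxBr e hb mulmxDr mulmxA.
have /pcov_ker [y hy] := kinclP x.
rewrite -/(rel_mx M) in hy *.
have -> : kincl (cov M) x *m H = 0 by rewrite hy -mulmxA h0 mulmx0.
by rewrite add0r.
Qed.

Definition Omega : stfunctor R.
Proof.
apply: (@StFunctor _ syz syz_map).
- move=> M N f g fg.
  have [H [K [h0 e]]] := lift_htpy (lift_mxE f) (lift_mxE g) fg.
  exact: (syz_eqI (syz_mapE f) (syz_mapE g) h0 e).
- move=> M.
  have [|H [K [h0 e]]] := lift_htpy (lift_mxE (lid M)) (Q := 1%:M) _ (stable_refl _).
    by move=> x; rewrite mulmx1.
  by apply: (syz_eqI (syz_mapE _) _ h0 e) => x; rewrite mulmx1.
- move=> M N K g f.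
  have [|H [Z [h0 e]]] := lift_htpy (lift_mxE (lcomp g f))
    (Q := lift_mx f *m lift_mx g) _ (stable_refl _).
    by move=> x; rewrite mulmxA !lift_mxE.
  apply: (syz_eqI (syz_mapE _) _ h0 e) => x.
  by rewrite mulmxA -!syz_mapE.
Defined.

(* dual_free identifies 'rV_n with Hom('rV_n, R); under it the dual of
   x |-> x *m A is c |-> c *m A^T, whence the transposed matrix in [transpose]. *)
Fact dual_free_linear n (c : 'rV[R]_n) :
  linear (fun x : 'rV[R]_n => (x *m c^T) 0 0 : R^o).
Proof. by move=> a x y; rewrite mulmxDl -scalemxAl !mxE. Qed.
Definition dual_free n (c : 'rV[R]_n) : {linear 'rV[R]_n -> R^o} :=
  mklin (dual_free_linear c).

Lemma dual_free_bij n (f : {linear 'rV[R]_n -> R^o}) :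
  exists! c, dual_free c =1 f.
Proof.
exists (\row_i f (delta_mx 0 i)); split.
  move=> x; rewrite /= [in RHS](row_sum_delta x) linear_sum mxE.
  by apply: eq_bigr => i _; rewrite !mxE linearZ.
move=> c hc; apply/rowP=> i; rewrite mxE -hc /= -rowE !mxE.
by [].
Qed.

Lemma dual_free_comp a b (A : 'M[R]_(a, b)) (c : 'rV[R]_b) (x : 'rV[R]_a) :
  dual_free c (x *m A) = dual_free (c *m A^T) x.
Proof. by rewrite /= trmx_mul trmxK mulmxA. Qed.

Definition tr_sort M : lmodType R := quotmod (imgp (lmx (rel_mx M)^T)).
Definition tr_pi M : {linear 'rV[R]_(rels M) -> tr_sort M} :=
  qpi (imgp (lmx (rel_mx M)^T)).

Definition tr_pres M : presentation (tr_sort M).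
Proof.
apply: (@Presentation _ _ _ _ (tr_pi M) (rel_mx M)^T) => [y|x].
  exact: qpi_surj.
split=> [/qpiP/asboolP[y <-]|[y ->]]; first by exists y.
by apply/qpiP/asboolP; exists y.
Defined.

Lemma tr_fp M : finitely_presented (tr_sort M).
Proof. by exists (tr_pres M). Qed.
Definition transpose M : fpmod R := FpMod (tr_fp M).

Lemma tr_pi_surj M y : exists x, tr_pi M x = y.
Proof. exact: (pcov_surj (tr_pres M)). Qed.
Lemma tr_pi0 M y : tr_pi M (y *m (rel_mx M)^T) = 0.
Proof. by apply/(@pcov_ker _ _ (tr_pres M)); exists y. Qed.

Lemma tr_desc M (W : lmodType R) (f : {linear 'rV[R]_(rels M) -> W}) :
  (forall y, f (y *m (rel_mx M)^T) = 0) ->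
  exists g : {linear transpose M -> W}, forall x, g (tr_pi M x) = f x.
Proof. exact: (@pres_desc _ _ (tr_pres M)). Qed.

Lemma tr_map_ex M N (f : {linear M -> N}) : exists g : {linear transpose N -> transpose M},
  forall x, g (tr_pi N x) = tr_pi M (x *m (rel_lift f)^T).
Proof.
apply: (@tr_desc N _ (lcomp (tr_pi M) (lmx (rel_lift f)^T))) => y.
rewrite -[LHS]/(tr_pi M (y *m (rel_mx N)^T *m (rel_lift f)^T)).
by rewrite -mulmxA -trmx_mul -rel_liftE trmx_mul mulmxA tr_pi0.
Qed.
Definition tr_map M N (f : {linear M -> N}) := projT1 (cid (tr_map_ex f)).
Lemma tr_mapE M N (f : {linear M -> N}) x :
  tr_map f (tr_pi N x) = tr_pi M (x *m (rel_lift f)^T).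
Proof. exact: (projT2 (cid (tr_map_ex f))). Qed.

Lemma tr_stable M (L : fpmod R) k (u v : {linear transpose M -> L})
    (X : 'M[R]_(rels M, k)) (b : {linear 'rV[R]_k -> L}) :
  (rel_mx M)^T *m X = 0 ->
  (forall x, u (tr_pi M x) - v (tr_pi M x) = b (x *m X)) -> stable_eq u v.
Proof.
move=> hX h; have [a ha] := pres_desc_mx (p := tr_pres M) hX.
apply: (@stable_eqF _ (transpose M) L u v _ a b) => y; have [x <-] := tr_pi_surj y.
by rewrite h -[tr_pi M]/(pcov (tr_pres M)) ha.
Qed.

Lemma tr_eqI M N (u v : {linear transpose N -> transpose M}) (P Q : 'M_(gens M, gens N))
    (P1 Q1 : 'M_(rels M, rels N)) H (K : 'M_(gens M, rels N)) :
  (forall x, u (tr_pi N x) = tr_pi M (x *m P1^T)) ->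
  (forall x, v (tr_pi N x) = tr_pi M (x *m Q1^T)) ->
  rel_mx M *m P = P1 *m rel_mx N -> rel_mx M *m Q = Q1 *m rel_mx N ->
  rel_mx M *m H = 0 -> P - Q = H + K *m rel_mx N -> stable_eq u v.
Proof.
move=> hu hv eP eQ h0 e.
apply: (@tr_stable N (transpose M) _ u v (P1 - Q1 - rel_mx M *m K)^T (tr_pi M)).
  rewrite -trmx_mul !mulmxBl -eP -eQ -mulmxBr e mulmxDr h0 add0r mulmxA.
  by rewrite subrr trmx0.
have -> : (P1 - Q1 - rel_mx M *m K)^T = P1^T - Q1^T - K^T *m (rel_mx M)^T.
  by rewrite !linearB /= trmx_mul.
move=> x; rewrite hu hv mulmxBr mulmxBr mulmxA linearB linearB.
by rewrite tr_pi0 subr0.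
Qed.

Definition Tr : stcofunctor R.
Proof.
apply: (@StCofunctor _ transpose tr_map).
- move=> M N f g fg.
  have [H [K [h0 e]]] := lift_htpy (lift_mxE f) (lift_mxE g) fg.
  exact: (tr_eqI (tr_mapE f) (tr_mapE g) (rel_liftE f) (rel_liftE g) h0 e).
- move=> M.
  have [|H [K [h0 e]]] := lift_htpy (lift_mxE (lid M)) (Q := 1%:M) _ (stable_refl _).
    by move=> x; rewrite mulmx1.
  apply: (tr_eqI (tr_mapE _) _ (rel_liftE _) (Q1 := 1%:M) _ h0 e) => [x|].
    by rewrite trmx1 mulmx1.
  by rewrite mulmx1 mul1mx.
- move=> M N K g f.
  have [|H [Z [h0 e]]] := lift_htpy (lift_mxE (lcomp g f))
    (Q := lift_mx f *m lift_mx g) _ (stable_refl _).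
    by move=> x; rewrite mulmxA !lift_mxE.
  apply: (tr_eqI (tr_mapE _) _ (rel_liftE _) (Q1 := rel_lift f *m rel_lift g) _ h0 e).
    by move=> x; rewrite trmx_mul mulmxA -!tr_mapE.
  by rewrite mulmxA rel_liftE -!mulmxA rel_liftE.
Defined.

Definition Sigma : stfunctor R := fsandwich Tr Omega.

End Functors.

Section SigmaOmega.
Variable R : comNzRingType.
Hypothesis noethR : noetherian R.
Implicit Types M N : fpmod R.

Local Notation syz := (syz noethR).

Lemma syz_mx_ex N : exists E : 'M[R]_(gens (syz N), gens N),
  forall x, x *m E = kincl (cov N) (cov (syz N) x).
Proof.
have [E hE] := lin_as_mx (lcomp (kincl (cov N)) (cov (syz N))).
by exists E => x; rewrite -hE.
Qed.
Definition syz_mx N := projT1 (cid (syz_mx_ex N)).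
Lemma syz_mxE N x : x *m syz_mx N = kincl (cov N) (cov (syz N) x).
Proof. exact: (projT2 (cid (syz_mx_ex N))). Qed.

Lemma syz_mx_cov N x : cov N (x *m syz_mx N) = 0.
Proof. by rewrite syz_mxE kinclP. Qed.

Lemma rel_syz_mx N : rel_mx (syz N) *m syz_mx N = 0.
Proof.
by apply: row_ext => x; rewrite mulmxA syz_mxE cov_rel0 linear0 mulmx0.
Qed.

Lemma syz_mx_ker N a (X : 'M_(a, _)) : X *m syz_mx N = 0 ->
  exists Z, X = Z *m rel_mx (syz N).
Proof.
move=> h; apply: cov_factor => x; apply: kincl_inj.
by rewrite -syz_mxE -mulmxA h mulmx0 linear0.
Qed.

Lemma syz_mx_im N a (X : 'M_(a, gens N)) : (forall x, cov N (x *m X) = 0) ->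
  exists Z, X = Z *m syz_mx N.
Proof.
move=> h; apply: mx_factor => x; have [b hb] := to_syz noethR h.
by have [y hy] := cov_surj (b x); exists y; rewrite syz_mxE hy hb.
Qed.

Lemma tr_factor M a (X : 'M_(a, rels M)) : (forall x, tr_pi M (x *m X) = 0) ->
  exists Z, X = Z *m (rel_mx M)^T.
Proof. exact: (@pres_factor _ _ (tr_pres M)). Qed.

Lemma trmx_eq0 a b c (X : 'M[R]_(a, b)) (Y : 'M[R]_(b, c)) :
  X *m Y = 0 -> Y^T *m X^T = 0.
Proof. by move=> h; rewrite -trmx_mul h trmx0. Qed.

Definition is_eta M (e : {linear M -> syz (transpose (syz (transpose M)))})
    (U' : 'M_(gens (transpose M), rels M)) (W' : 'M_(gens (syz (transpose M)), gens M))
    (L : 'M_(rels (syz (transpose M)), gens (transpose (syz (transpose M))))) : Prop :=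
  [/\ forall x, tr_pi M (x *m U') = cov (transpose M) x,
      syz_mx (transpose M) *m U' = W' *m (rel_mx M)^T,
      forall x, cov (transpose (syz (transpose M))) (x *m L) = tr_pi (syz (transpose M)) x &
      forall x, kincl (cov (transpose (syz (transpose M)))) (e (cov M x)) =
                x *m (W'^T *m (rel_mx (syz (transpose M)))^T *m L)].

Lemma eta_ex M : exists (e : {linear M -> syz (transpose (syz (transpose M)))}),
  exists U' W' L, is_eta e U' W' L.
Proof.
set T := transpose M; set S := syz T; set V := transpose S.
have [U' hU'] := mx_lift (cov T) (@tr_pi_surj _ M).
have [|W' hW'] := @tr_factor M _ (syz_mx T *m U').
  by move=> x; rewrite mulmxA hU' syz_mx_cov.
have [L hL] := mx_lift (tr_pi S) (@cov_surj _ V).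
pose B := W'^T *m (rel_mx S)^T *m L.
have [|b hb] := @to_syz _ noethR V _ B.
  by move=> x; rewrite /B mulmxA mulmxA hL tr_pi0.
have AB : rel_mx M *m B = 0.
  rewrite /B !mulmxA -[rel_mx M]trmxK -trmx_mul -hW' trmx_mul.
  by rewrite -(mulmxA U'^T) trmx_eq0 ?rel_syz_mx // mulmx0 mul0mx.
have [|e he] := @pres_desc _ _ (pres M) _ b.
  by move=> y; apply: kincl_inj; rewrite hb -mulmxA AB mulmx0 linear0.
exists e, U', W', L; split=> // x.
by rewrite /cov he hb.
Qed.

Definition eta1 M : {linear M -> Omega noethR (Sigma noethR M)} :=
  projT1 (cid (eta_ex M)).
Lemma eta1P M : exists U' W' L, is_eta (eta1 M) U' W' L.
Proof. exact: (projT2 (cid (eta_ex M))). Qed.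

Lemma eta_nat_mx a a' b c d e k l m (W1 : 'M[R]_(a, b)) (C1 : 'M_(b, c))
    (L1 : 'M_(c, d)) (J : 'M_(d, e)) (H1 : 'M_(c, k)) (L2 : 'M_(k, e))
    (H0 : 'M_(b, l)) (C2 : 'M_(l, k)) (F0 : 'M_(a, a')) (W2 : 'M_(a', l))
    (Q : 'M_(a, m)) (E : 'M_(m, l)) :
  C1 *m H1 = H0 *m C2 -> E *m C2 = 0 ->
  W1 *m C1 *m L1 *m J - F0 *m (W2 *m C2 *m L2) =
  W1 *m C1 *m (L1 *m J - H1 *m L2) + (W1 *m H0 - F0 *m W2 - Q *m E) *m (C2 *m L2).
Proof.
move=> CH EC; rewrite !mulmxBl mulmxBr -(mulmxA Q) (mulmxA E) EC mul0mx mulmx0 subr0.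
rewrite -(mulmxA W1 C1 (H1 *m L2)) (mulmxA C1) CH !mulmxA.
by rewrite addrA subrK.
Qed.

Lemma eta_ex_mx a b c d e m (W' : 'M[R]_(a, b)) (C : 'M_(b, c))
    (L : 'M_(c, d)) (G : 'M_(d, e)) (Y : 'M_(c, e)) (P : 'M_(a, e))
    (W : 'M_(b, a)) (Q : 'M_(a, m)) (A : 'M_(m, a)) :
  C *m Y = W *m P -> A *m P = 0 ->
  W' *m C *m L *m G - P =
  W' *m C *m (L *m G - Y) + (W' *m W - 1%:M - Q *m A) *m P.
Proof.
move=> CY AP; rewrite !mulmxBl mulmxBr -(mulmxA Q) AP mulmx0 subr0 mul1mx.
by rewrite -(mulmxA W' C Y) CY !mulmxA addrA subrK.
Qed.

Lemma eta_inj_mx b c d e f g a (W : 'M[R]_(b, a)) (W' : 'M_(a, b)) (C : 'M_(b, c))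
    (L : 'M_(c, d)) (G : 'M_(d, e)) (H : 'M_(a, f)) (K : 'M_(f, e)) (Q : 'M_(b, g))
    (E : 'M_(g, b)) (Z : 'M_(c, b)) (Y : 'M_(c, f)) :
  W *m W' - 1%:M - Q *m E = C *m Z -> E *m C = 0 -> W *m H = C *m Y ->
  W' *m C *m L *m G = H *m K ->
  C *m ((1%:M + Z *m C) *m L *m G - Y *m K) = 0.
Proof.
move=> hZ EC hY hG.
have hC : W *m W' *m C = C *m (1%:M + Z *m C).
  rewrite mulmxDr mulmx1 mulmxA -hZ !mulmxBl mul1mx -(mulmxA Q) EC mulmx0 subr0.
  by rewrite addrC subrK.
by rewrite mulmxBr !mulmxA -hC -hY -(mulmxA W H) -hG !mulmxA subrr.
Qed.

Lemma syz_free M N (u v : {linear M -> syz N}) k (X : 'M_(gens M, k))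
    (B : 'M_(k, gens N)) :
  rel_mx M *m X = 0 -> (forall x, cov N (x *m B) = 0) ->
  (forall x, kincl (cov N) (u (cov M x)) - kincl (cov N) (v (cov M x)) =
             x *m X *m B) -> stable_eq u v.
Proof.
move=> h0 hB h; have [b hb] := to_syz noethR hB.
apply: (@stable_eqX _ M (syz N) u v _ X b) => // x.
by apply: kincl_inj; rewrite linearB h hb.
Qed.

Lemma eta1_nat M N (f : {linear M -> N}) :
  stable_eq (lcomp (fmap (Omega noethR) (fmap (Sigma noethR) f)) (eta1 M))
            (lcomp (eta1 N) f).
Proof.
have [U1 [W1 [L1 [hU1 hW1 hL1 he1]]]] := eta1P M.
have [U2 [W2 [L2 [hU2 hW2 hL2 he2]]]] := eta1P N.
move: (eta1 M) he1 (eta1 N) he2 => e1 he1 e2 he2.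
pose TM := transpose M; pose TN := transpose N; pose SM := syz TM; pose SN := syz TN.
pose VM := transpose SM; pose VN := transpose SN.
pose t := tr_map f; pose s := syz_map noethR t; pose v := tr_map s.
pose F0 := lift_mx f; pose F1 := rel_lift f; pose G0 := lift_mx t.
pose H0 := lift_mx s; pose H1 := rel_lift s; pose J := lift_mx v.
have EH : syz_mx TN *m G0 = H0 *m syz_mx TM.
  apply: row_ext => x; by rewrite !mulmxA !syz_mxE lift_mxE syz_mapE.
have [Z hZ] : exists Z, L1 *m J - H1^T *m L2 = Z *m rel_mx VN.
  apply: cov_factor => x; rewrite mulmxBr linearB !mulmxA lift_mxE hL1 hL2.
  by rewrite tr_mapE subrr.
have [Q hQ] : exists Q, G0 *m U1 - U2 *m F1^T = Q *m (rel_mx M)^T.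
  apply: tr_factor => x; rewrite mulmxBr linearB !mulmxA hU1 lift_mxE.
  by rewrite -tr_mapE hU2 subrr.
pose X := W1^T *m H0^T - F0 *m W2^T - Q^T *m (syz_mx TN)^T.
have hQT : U1^T *m G0^T - F1 *m U2^T = rel_mx M *m Q^T.
  by rewrite -[rel_mx M]trmxK -[RHS]trmx_mul -hQ linearB /= !trmx_mul trmxK.
have hW1T : rel_mx M *m W1^T = U1^T *m (syz_mx TM)^T.
  by rewrite -trmx_mul hW1 trmx_mul trmxK.
have hW2T : rel_mx N *m W2^T = U2^T *m (syz_mx TN)^T.
  by rewrite -trmx_mul hW2 trmx_mul trmxK.
have AX : rel_mx M *m X = 0.
  rewrite /X !mulmxBr !mulmxA -hQT hW1T rel_liftE -!mulmxA hW2T -trmx_mul -EH.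
  by rewrite -/F1 trmx_mul !mulmxA -mulmxBl subrr.
pose C1 := (rel_mx SM)^T; pose C2 := (rel_mx SN)^T.
have AWC : rel_mx M *m (W1^T *m C1) = 0.
  by rewrite mulmxA hW1T -mulmxA trmx_eq0 ?rel_syz_mx ?mulmx0.
have EC : (syz_mx TN)^T *m C2 = 0 by rewrite trmx_eq0 ?rel_syz_mx.
have CH : C1 *m H1^T = H0^T *m C2.
  by rewrite -!trmx_mul rel_liftE.
have e2f x : kincl (cov VN) (e2 (f (cov M x))) = x *m (F0 *m (W2^T *m C2 *m L2)).
  by rewrite -lift_mxE he2 !mulmxA.
have v1 x : kincl (cov VN) (syz_map noethR v (e1 (cov M x))) =
            x *m (W1^T *m C1 *m L1 *m J).
  by rewrite syz_mapE he1 -!mulmxA.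
apply: (@syz_free M VN _ _ _ (row_mx (W1^T *m C1 *m Z) X)
           (col_mx (rel_mx VN) (C2 *m L2))).
- by rewrite mul_mx_row AX mulmxA AWC mul0mx row_mx0.
- move=> x; rewrite -[x]hsubmxK mul_row_col linearD cov_rel0 mulmxA hL2 tr_pi0.
  by rewrite addr0.
- move=> x; rewrite [X in X - _]v1 [X in _ - X]e2f -mulmxBr -[RHS]mulmxA mul_row_col.
  congr (_ *m _).
  rewrite -[_ *m Z *m _]mulmxA -hZ.
  exact: eta_nat_mx CH EC.
Qed.

Lemma eta1_ex M N (f : {linear M -> Omega noethR N}) :
  exists g : {linear Sigma noethR M -> N},
    stable_eq (lcomp (fmap (Omega noethR) g) (eta1 M)) f.
Proof.
have [U' [W' [L [hU' hW' hL he]]]] := eta1P M.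
move: (eta1 M) he => e he.
pose T := transpose M; pose S := syz T; pose V := transpose S.
pose A := rel_mx M; pose E := syz_mx T; pose C := rel_mx S.
have [U hU] := mx_lift (tr_pi M) (@cov_surj _ T).
have [W hW] : exists W, A^T *m U = W *m E.
  by apply: syz_mx_im => x; rewrite mulmxA hU tr_pi0.
have [Q hQ] : exists Q, U *m U' - 1%:M = Q *m A^T.
  by apply: tr_factor => x; rewrite mulmxBr linearB mulmxA hU' hU mulmx1 subrr.
have hW'T : A *m W'^T = U'^T *m E^T.
  by rewrite -trmx_mul hW' trmx_mul trmxK.
have hWT : E^T *m W^T = U^T *m A.
  by rewrite -trmx_mul -hW trmx_mul trmxK.
have hQT : U'^T *m U^T - 1%:M = A *m Q^T.
  by rewrite -[A]trmxK -[RHS]trmx_mul -hQ linearB /= trmx_mul trmx1.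
have [P hP] := lin_as_mx (lcomp (kincl (cov N)) (lcomp f (cov M))).
have AP : A *m P = 0.
  by apply: row_ext => x; rewrite mulmxA -hP /= [cov M _]cov_rel0 !linear0.
have [Y0 hY0] : exists Y0, (W^T *m P)^T = Y0 *m C.
  apply: syz_mx_ker; rewrite -[syz_mx _]trmxK trmx_eq0 // mulmxA hWT -mulmxA.
  by rewrite AP mulmx0.
pose Y := Y0^T.
have hY : W^T *m P = C^T *m Y by rewrite -[LHS]trmxK hY0 trmx_mul.
have covP x : cov N (x *m P) = 0 by rewrite -hP; exact: kinclP.
have [|g hg] := @tr_desc _ S _ (lcomp (cov N) (lmx Y)).
  move=> y; rewrite -[LHS]/(cov N (y *m C^T *m Y)).
  by rewrite -mulmxA -hY mulmxA covP.
exists g.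
have [Z hZ] : exists Z, L *m lift_mx g - Y = Z *m rel_mx N.
  apply: cov_factor => x; rewrite mulmxBr linearB mulmxA lift_mxE hL hg.
  exact: subrr.
pose H := W'^T *m W^T - 1%:M - Q^T *m A.
have AH : A *m H = 0.
  rewrite /H !mulmxBr mulmx1 !mulmxA -hQT hW'T -mulmxA hWT mulmxBl mulmxA mul1mx.
  by rewrite subrr.
have AWC : A *m (W'^T *m C^T) = 0.
  by rewrite mulmxA hW'T -mulmxA trmx_eq0 ?rel_syz_mx ?mulmx0.
apply: (@syz_free M N _ _ _ (row_mx (W'^T *m C^T *m Z) H) (col_mx (rel_mx N) P)).
- by rewrite mul_mx_row AH mulmxA AWC mul0mx row_mx0.
- by move=> x; rewrite -[x]hsubmxK mul_row_col linearD cov_rel0 covP addr0.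
- move=> x; rewrite [kincl _ (f _)]hP [X in X - _]syz_mapE he.
  rewrite -[X in X - _]mulmxA -mulmxBr -[RHS]mulmxA mul_row_col; congr (_ *m _).
  rewrite -[_ *m Z *m _]mulmxA -hZ.
  exact: eta_ex_mx (esym hY) AP.
Qed.

Lemma eta1_inj M N (g g' : {linear Sigma noethR M -> N}) :
  stable_eq (lcomp (fmap (Omega noethR) g) (eta1 M))
            (lcomp (fmap (Omega noethR) g') (eta1 M)) ->
  stable_eq g g'.
Proof.
have [U' [W' [L [hU' hW' hL he]]]] := eta1P M.
move: (eta1 M) he => e he.
pose T := transpose M; pose S := syz T; pose V := transpose S.
pose A := rel_mx M; pose E := syz_mx T; pose C := rel_mx S.
have [U hU] := mx_lift (tr_pi M) (@cov_surj _ T).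
have [W hW] : exists W, A^T *m U = W *m E.
  by apply: syz_mx_im => x; rewrite mulmxA hU tr_pi0.
have [Q hQ] : exists Q, U' *m U - 1%:M = Q *m E.
  by apply: syz_mx_im => x; rewrite mulmxBr linearB mulmxA hU hU' mulmx1 subrr.
have hW'T : A *m W'^T = U'^T *m E^T.
  by rewrite -trmx_mul hW' trmx_mul trmxK.
have hWT : E^T *m W^T = U^T *m A.
  by rewrite -trmx_mul -hW trmx_mul trmxK.
have hQT : U^T *m U'^T - 1%:M = E^T *m Q^T.
  by rewrite -[RHS]trmx_mul -hQ linearB /= trmx_mul trmx1.
have EC : E^T *m C^T = 0 by rewrite trmx_eq0 ?rel_syz_mx.
have ext k (X : 'M_(_, k)) : E^T *m X = 0 -> exists Y, X = C^T *m Y.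
  move=> h; have [|Z hZ] := @syz_mx_ker T _ X^T.
    by rewrite -[syz_mx _]trmxK trmx_eq0.
  by exists Z^T; rewrite -trmx_mul -hZ trmxK.
move=> /stable_eqE [H AH hH].
have [K hK] := lin_as_mx (lcomp (kincl (cov N)) (cov (syz N))).
have covK x : cov N (x *m K) = 0 by rewrite -hK; exact: kinclP.
pose G := lift_mx g - lift_mx g'.
have hG : W'^T *m C^T *m L *m G = H *m K.
  apply: row_ext => x; have := congr1 (kincl (cov N)) (hH x).
  rewrite linearB [X in X - _]syz_mapE [X in _ - X]syz_mapE he -mulmxBr.
  by rewrite -[RHS]/(lcomp (kincl (cov N)) (cov (syz N)) (x *m H)) hK -!mulmxA.
have [Z hZ] : exists Z, W^T *m W'^T - 1%:M - Q^T *m E^T = C^T *m Z.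
  apply: ext; rewrite !mulmxBr mulmx1 !mulmxA -hQT hWT -mulmxA hW'T.
  by rewrite mulmxBl mul1mx mulmxA subrr.
have [Y hY] : exists Y, W^T *m H = C^T *m Y.
  by apply: ext; rewrite mulmxA hWT -mulmxA AH mulmx0.
pose X := (1%:M + Z *m C^T) *m L *m G - Y *m K.
have CX : C^T *m X = 0 by exact: eta_inj_mx hZ EC hY hG.
apply: (@tr_stable _ S N _ g g' X (cov N)) => // x.
have gG y : cov N (y *m L *m G) = g (tr_pi S y) - g' (tr_pi S y).
  by rewrite /G mulmxBr linearB !lift_mxE hL.
rewrite /X mulmxBr linearB (mulmxA x Y) covK subr0 !mulmxA gG.
by rewrite mulmxDr mulmx1 mulmxA linearD tr_pi0 addr0.
Qed.

Definition Sigma_Omega_adj : adjunction (Sigma noethR) (Omega noethR) :=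
  Adjunction eta1_nat eta1_ex eta1_inj.

End SigmaOmega.

Section Invariants.
Variable R : comNzRingType.

(* Ideals of R are the submodules of R^o. *)
Definition maximal_ideal (I : submodClosed R^o) : Prop :=
  (1 : R) \notin I /\
  forall J : submodClosed R^o, (1 : R) \notin J -> {subset I <= J} -> {subset J <= I}.

Definition local_ring (m : submodClosed R^o) : Prop :=
  maximal_ideal m /\ forall I : submodClosed R^o, maximal_ideal I -> I =i m.

Lemma residue_fp (m : submodClosed R^o) :
  noetherian R -> finitely_presented (quotmod m).
Proof.
move=> noethR; have [n [g hg]] := noethR m.
have pl : linear (fun x : 'rV[R]_1 => qpi m (x 0 0 : R^o)).
  by move=> a x y; rewrite -linearP !mxE.
unshelve eexists; last by [].
apply: (@Presentation _ _ 1 n (mklin pl) (\col_i g i)) => [y|x].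
  by have [r <-] := qpi_surj y; exists (\row_i r); rewrite /= mxE.
split=> [/qpiP/hg[c hc]|[y ->]].
  exists (\row_i c i); apply/rowP=> i; rewrite ord1 hc mxE.
  by apply: eq_bigr => j _; rewrite !mxE.
apply/qpiP/hg; exists (fun i => y 0 i); rewrite mxE.
by apply: eq_bigr => j _; rewrite mxE.
Qed.

(* Extended natural numbers are [option nat], with [None] for infinity. *)
Definition inf_nat (S : nat -> Prop) : option nat :=
  match pselect (exists n, `[< S n >]) with
  | left h => Some (ex_minn h)
  | right _ => None
  end.

Definition sup_nat (S : nat -> Prop) : option nat :=
  inf_nat (fun n => forall m, S m -> (m <= n)%N).

Record resolution (M : lmodType R) := Resolution {
  res : nat -> lmodType R;
  res_d : forall i, {linear res i.+1 -> res i};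
  res_aug : {linear res 0 -> M};
  res_projective : forall i, projective (res i);
  res_aug_surj : forall y, exists x, res_aug x = y;
  res_exact0 : forall x, res_aug x = 0 <-> exists y, x = res_d 0 y;
  res_exact : forall i x, res_d i x = 0 <-> exists y, x = res_d i.+1 y }.

Definition projdim (M : lmodType R) : option nat :=
  inf_nat (fun n => exists P : resolution M,
    forall i, (n < i)%N -> forall x : res P i, x = 0).

Definition findim : option nat :=
  sup_nat (fun n => exists M : fpmod R, projdim M = Some n).

Definition cocycle (M N : lmodType R) (P : resolution M) i
    (f : {linear res P i -> N}) : Prop :=
  forall x, f (res_d P i x) = 0.

Definition coboundary (M N : lmodType R) (P : resolution M) i :
    {linear res P i -> N} -> Prop :=
  match i with
  | 0 => fun f => forall x, f x = 0
  | j.+1 => fun f => exists g : {linear res P j -> N}, forall x, f x = g (res_d P j x)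
  end.

(* Ext^i(M, N) is the i-th cohomology of Hom(P, N); it does not depend on the
   projective resolution P of M. *)
Definition Ext_nonzero i (M N : lmodType R) : Prop :=
  exists (P : resolution M) (f : {linear res P i -> N}), cocycle f /\ ~ coboundary f.

Hypothesis noethR : noetherian R.

Definition residue_field (m : submodClosed R^o) : fpmod R :=
  FpMod (residue_fp m noethR).

Definition depth (m : submodClosed R^o) : option nat :=
  inf_nat (fun i => Ext_nonzero i (residue_field m) R^o).

Definition Omega_pow n : stfunctor R := fpowr (Omega noethR) n.
Definition Sigma_pow n : stfunctor R := fpow (Sigma noethR) n.

Definition Sigma_Omega_pow_adj n : adjunction (Sigma_pow n) (Omega_pow n) :=
  adj_pow (Sigma_Omega_adj noethR) n.

Definition eta n (M : fpmod R) : {linear M -> Omega_pow n (Sigma_pow n M)} :=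
  adj_unit (Sigma_Omega_pow_adj n) M.

Definition dell (M : fpmod R) : option nat :=
  inf_nat (fun n => exists N : fpmod R,
    stable_retract (Omega_pow n M) (Omega_pow n.+1 N)).

Definition dell_ring (m : submodClosed R^o) : option nat :=
  dell (residue_field m).

End Invariants.

(* Main.v *)
(* Write K_l for Omega^l k. Depth is compared with the other invariants through
   Ext^l(k, Y) = Hom(K_l, Y) / (maps extending to the free cover of K_(l-1)) and its
   long exact sequence in Y.
   - The depth is finite: if Ext^l(k, R) = 0 for all l, then the Koszul complex on
     generators of m is exact, so that k = 0.
   - Let d be the depth and X_0 = K_d. Taking successive left approximations
     0 -> X_i -> 'rV_n -> X_(i+1) -> 0 one gets X_i = Sigma^i K_d stably, as long as the
     X_i are torsionless. By induction X_i maps to K_(d-i), multiplication by a in m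
     factors stably through this map, so a torsion element of X_i spans a copy of k; it
     dies since Ext^l(k, R) = 0 for l < d, except for a section of X_d -> k, which
     Ext^d(X_d, R) = 0 <> Ext^d(k, R) excludes. The unit of (Sigma, Omega) is a stable
     equivalence at a torsionless module, and eta_(d+1) is composed of such units.
   - If Ext^l(k, R) = 0 for l <= n, every map from K_n to an (n+1)-st syzygy extends to
     the free cover of K_(n-1). If K_n were a stable retract of such a syzygy,
     id_(K_n), hence id_k, would be zero in Ext.
   - findim R >= d by the dual of the resolution of k cut off in degree d; findim R <= d
     since a syzygy Y of order at least d whose minimal cover has a projective kernel is
     itself projective. *)

From HB Require Import structures.
Require Import Defs.
From mathcomp Require Import all_boot all_algebra.
From mathcomp Require Import boolp classical_sets.

Set Implicit Arguments.
Unset Strict Implicit.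
Unset Printing Implicit Defensive.

Import GRing.Theory.
Local Open Scope ring_scope.

(** * Short exact sequences and the long exact sequence of Ext *)

Section LinearMaps.
Variable R : comNzRingType.
Implicit Types U V W T : lmodType R.

Definition ladd U V (f g : {linear U -> V}) : {linear U -> V} := f \+ g.
Definition lsub U V (f g : {linear U -> V}) : {linear U -> V} := f \- g.
Definition lscale U V a (f : {linear U -> V}) : {linear U -> V} := a \*: f.
Definition lzero U V : {linear U -> V} := \0.

Lemma lin_desc U V W (q : {linear U -> V}) (f : {linear U -> W}) :
  (forall y, exists x, q x = y) -> (forall x, q x = 0 -> f x = 0) ->
  exists g : {linear V -> W}, forall x, g (q x) = f x.
Proof.
move=> qs h; pose s y := projT1 (cid (qs y)).
have sE y : q (s y) = y by exact: (projT2 (cid (qs y))).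
have fE x y : q x = q y -> f x = f y.
  move=> e; apply/eqP; rewrite -subr_eq0 -linearB; apply/eqP/h.
  by rewrite linearB e subrr.
have gl : linear (f \o s).
  by move=> c x y; rewrite /= -linearP; apply: fE; rewrite linearP !sE.
by exists (mklin gl) => x; apply: fE; rewrite sE.
Qed.

Lemma lin_inj U V (u : {linear U -> V}) :
  (forall x, u x = 0 -> x = 0) -> injective u.
Proof.
by move=> h x y e; apply/eqP; rewrite -subr_eq0; apply/eqP/h; rewrite linearB e subrr.
Qed.

Lemma lin_corestr U V W (u : {linear U -> V}) (f : {linear W -> V}) :
  (forall x, u x = 0 -> x = 0) -> (forall x, exists y, f x = u y) ->
  exists g : {linear W -> U}, forall x, u (g x) = f x.
Proof.
move=> /lin_inj ui h; pose s y := projT1 (cid (h y)).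
have sE y : u (s y) = f y by rewrite (projT2 (cid (h y))).
have gl : linear s by move=> c x y; apply: ui; rewrite linearP !sE linearP.
by exists (mklin gl) => x; rewrite -sE.
Qed.

Definition short_exact U V W (u : {linear U -> V}) (q : {linear V -> W}) : Prop :=
  [/\ forall x, u x = 0 -> x = 0, forall y, exists x, q x = y &
      forall x, q x = 0 <-> exists y, x = u y].

Lemma short_exact0 U V W (u : {linear U -> V}) (q : {linear V -> W}) x :
  short_exact u q -> q (u x) = 0.
Proof. by case=> _ _ h; apply/h; exists x. Qed.

Lemma short_exact_ker U V (q : {linear U -> V}) :
  (forall y, exists x, q x = y) -> short_exact (kincl q) q.
Proof.
move=> qs; split=> // [x e|x]; first by apply: kincl_inj; rewrite e linear0.
split=> [/eqP h|[y ->]]; last exact: kinclP.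
by exists (KerMod (h : x \in kerp q)).
Qed.

Lemma short_exact_quot U V (u : {linear U -> V}) :
  (forall x, u x = 0 -> x = 0) -> short_exact u (qpi (imgp u)).
Proof.
move=> ui; split=> // [|x]; first exact: qpi_surj.
split=> [/qpiP/asboolP[y <-]|[y ->]]; first by exists y.
by apply/qpiP/asboolP; exists y.
Qed.

Lemma ses_lift U V W (u : {linear U -> V}) (q : {linear V -> W}) T
    (f : {linear T -> V}) : short_exact u q -> (forall x, q (f x) = 0) ->
  exists g : {linear T -> U}, forall x, u (g x) = f x.
Proof.
by move=> [ui _ ex] h; have [|g hg] := lin_corestr (f := f) ui; [move=> x; apply/ex|exists g].
Qed.

Lemma ses_desc U V W (u : {linear U -> V}) (q : {linear V -> W}) T
    (f : {linear V -> T}) : short_exact u q -> (forall x, f (u x) = 0) ->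
  exists g : {linear W -> T}, forall x, g (q x) = f x.
Proof.
by move=> [_ qs ex] h; have [x /ex[y ->]|g hg] := lin_desc (f := f) qs; [exact: h|exists g].
Qed.

End LinearMaps.

Section ExtClasses.
Variable R : comNzRingType.
Hypothesis noethR : noetherian R.
Implicit Types (U V W Y Z : lmodType R) (M : fpmod R).

Local Notation syz := (syz noethR).
Local Notation K M l := (iter l syz M).
Local Notation F M l := 'rV[R]_(gens (K M l)).

Lemma short_exact_cov M : short_exact (kincl (cov M)) (cov M).
Proof. exact/short_exact_ker/cov_surj. Qed.

(* Ext^l(M, Y) is Hom(Omega^l M, Y) modulo the maps which extend along the
   inclusion of Omega^l M in the preceding free module, or modulo 0 if l = 0. *)
Definition ext_zero M l Y : {linear K M l -> Y} -> Prop :=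
  match l return {linear K M l -> Y} -> Prop with
  | 0 => fun f => forall x, f x = 0
  | l.+1 => fun f => exists s : {linear F M l -> Y},
      forall x, f x = s (kincl (cov (K M l)) x)
  end.

Definition ext_vanish M l Y : Prop := forall f : {linear K M l -> Y}, ext_zero f.

Lemma ext_zero_ext M l Y (f g : {linear K M l -> Y}) :
  f =1 g -> ext_zero f -> ext_zero g.
Proof.
case: l f g => [|l] f g e /=; first by move=> h x; rewrite -e.
by case=> s h; exists s => x; rewrite -e.
Qed.

Lemma ext_zero_comp M l Y Z (f : {linear K M l -> Y}) (g : {linear Y -> Z}) :
  ext_zero f -> ext_zero (lcomp g f).
Proof.
case: l f => [|l] f /=; first by move=> h x; rewrite h linear0.
by case=> s h; exists (lcomp g s) => x; rewrite /= h.
Qed.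

Lemma ext_zero_add M l Y (f g : {linear K M l -> Y}) :
  ext_zero f -> ext_zero g -> ext_zero (ladd f g).
Proof.
case: l f g => [|l] f g /=; first by move=> h h' x; rewrite h h' addr0.
by case=> s h [t h']; exists (ladd s t) => x; rewrite /= h h'.
Qed.

Lemma ext_zero_scale M l Y a (f : {linear K M l -> Y}) :
  ext_zero f -> ext_zero (lscale a f).
Proof.
case: l f => [|l] f /=; first by move=> h x; rewrite h scaler0.
by case=> s h; exists (lscale a s) => x; rewrite /= h.
Qed.

Lemma ext_zero0 M l Y : ext_zero (@lzero R (K M l) Y).
Proof. by case: l => [|l] //=; exists (lzero _ _). Qed.

Lemma ext_zero_lift M l V W (f : {linear K M l -> W}) (q : {linear V -> W}) :
  (forall y, exists x, q x = y) -> ext_zero f ->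
  exists2 g : {linear K M l -> V}, ext_zero g & forall x, q (g x) = f x.
Proof.
move=> qs; case: l f => [|l] f /=.
  by move=> h; exists (lzero _ _) => // x; rewrite h linear0.
case=> s h; have [t ht] := free_lift s qs.
by exists (lcomp t (kincl (cov (K M l)))); [exists t|move=> x; rewrite /= ht h].
Qed.

(** The connecting map Ext^l(M, W) -> Ext^(l+1)(M, U) as a relation between representatives: the
    lift [h] is a choice, and another one changes [g] by an [ext_zero] map. *)
Definition connecting U V W (u : {linear U -> V}) (q : {linear V -> W}) M l
    (f : {linear K M l -> W}) (g : {linear K M l.+1 -> U}) : Prop :=
  exists2 h : {linear F M l -> V}, forall x, q (h x) = f (cov (K M l) x) &
    forall x, u (g x) = h (kincl (cov (K M l)) x).

Section Connecting.
Variables (U V W : lmodType R) (u : {linear U -> V}) (q : {linear V -> W}).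
Hypothesis ses : short_exact u q.
Variables (M : fpmod R) (l : nat).

Lemma connecting_ex (f : {linear K M l -> W}) : exists g, connecting u q f g.
Proof.
have [_ qs _] := ses; have [h hh] := free_lift (lcomp f (cov (K M l))) qs.
have [|g hg] := ses_lift (f := lcomp h (kincl (cov (K M l)))) ses.
  by move=> x; rewrite /= hh /= kinclP linear0.
by exists g; exists h.
Qed.

Lemma connecting_inv (g : {linear K M l.+1 -> U}) :
  ext_zero (lcomp u g) -> exists f, connecting u q f g.
Proof.
case=> h hh; have [|f hf] := ses_desc (f := lcomp q h) (short_exact_cov (K M l)).
  by move=> x; rewrite /= -hh /= (short_exact0 _ ses).
by exists f; exists h.
Qed.

Lemma connecting_zero (f : {linear K M l -> W}) g :
  connecting u q f g -> ext_zero f -> ext_zero g.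
Proof.
have [ui qs _] := ses; move=> [h hq hu] /(ext_zero_lift qs) [k _ hk].
have [|s hs] := ses_lift (f := lsub h (lcomp k (cov (K M l)))) ses.
  by move=> x; rewrite /= linearB hq hk subrr.
exists s => x; apply: (lin_inj ui); rewrite hs hu /= kinclP.
by rewrite linear0 subr0.
Qed.

(** Exactness at Ext^l(M, W): an extension [s] of [g] corrects [h] to [h - u s], which descends to a
    map into [V] lifting [f]. *)
Lemma connecting_zero_inv (f : {linear K M l -> W}) g :
  connecting u q f g -> ext_vanish M l V -> ext_zero g -> ext_zero f.
Proof.
move=> [h hq hu] vV [s hs].
have [|k hk] := ses_desc (f := lsub h (lcomp u s)) (short_exact_cov (K M l)).
  by move=> x; rewrite /= -hu -hs subrr.
apply: ext_zero_ext (ext_zero_comp q (vV k)) => y; have [x <-] := cov_surj y.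
by rewrite /= hk /= linearB hq (short_exact0 _ ses) subr0.
Qed.

Lemma connecting_sub (f f' : {linear K M l -> W}) g g' :
  connecting u q f g -> connecting u q f' g' ->
  connecting u q (lsub f f') (lsub g g').
Proof.
move=> [h hq hu] [h' hq' hu']; exists (lsub h h') => x.
  by rewrite /= linearB hq hq'.
by rewrite /= linearB hu hu'.
Qed.

Lemma ext_vanish_quot :
  ext_vanish M l V -> ext_vanish M l.+1 U -> ext_vanish M l W.
Proof.
move=> vV vU f; have [g fg] := connecting_ex f.
exact: connecting_zero_inv fg vV (vU g).
Qed.

Lemma ext_vanish_sub :
  ext_vanish M l.+1 V -> ext_vanish M l W -> ext_vanish M l.+1 U.
Proof.
move=> vV vW g; have [f fg] := connecting_inv (vV (lcomp u g)).
exact: connecting_zero fg (vW f).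
Qed.

End Connecting.

Lemma ext_vanish_inj U V (u : {linear U -> V}) M :
  (forall x, u x = 0 -> x = 0) -> ext_vanish M 0 V -> ext_vanish M 0 U.
Proof. by move=> ui vV f x; apply: ui; exact: (vV (lcomp u f)). Qed.

Lemma connecting_map U V W (u : {linear U -> V}) (q : {linear V -> W}) U' V' W'
    (u' : {linear U' -> V'}) (q' : {linear V' -> W'})
    (c : {linear U -> U'}) (ct : {linear V -> V'}) (c' : {linear W -> W'})
    M l (f : {linear K M l -> W}) g :
  (forall x, ct (u x) = u' (c x)) -> (forall x, c' (q x) = q' (ct x)) ->
  connecting u q f g -> connecting u' q' (lcomp c' f) (lcomp c g).
Proof.
move=> hu hq [h hf hg]; exists (lcomp ct h) => x /=; first by rewrite -hq hf.
by rewrite -hu hg.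
Qed.

Lemma connecting_scale M l a :
  connecting (kincl (cov (K M l))) (cov (K M l))
    (lscale a (lid (K M l))) (lscale a (lid (K M l.+1))).
Proof. by exists (lscale a (lid _)) => x; rewrite ?linearZ. Qed.

(** Every class is an image of the class of the identity of Omega^l M, so only [a] times the
    identity matters; by [connecting_scale] its vanishing passes from l to l + 1. *)
Lemma ext_zero_annihilator M a l Y (f : {linear K M l -> Y}) :
  (forall x : M, a *: x = 0) -> ext_zero (lscale a f).
Proof.
move=> aM; have h : ext_zero (lscale a (lid (K M l))).
  elim: l {Y f} => [|l IH]; first by move=> x; exact: aM.
  exact: (connecting_zero (short_exact_cov (K M l)) (connecting_scale M l a) IH).
by apply: ext_zero_ext (ext_zero_comp f h) => x /=; rewrite linearZ.
Qed.

Fact entry_linear n i : linear (fun x : 'rV[R]_n => x 0 i : R^o).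
Proof. by move=> a x y; rewrite !mxE. Qed.
Definition entry n i : {linear 'rV[R]_n -> R^o} := mklin (@entry_linear n i).

Lemma ext_zero_row M l n (f : {linear K M l -> 'rV[R]_n}) :
  (forall i, ext_zero (lcomp (entry i) f)) -> ext_zero f.
Proof.
case: l f => [|l] f h; first by move=> x; apply/rowP=> i; rewrite mxE; exact: h.
pose s i := projT1 (cid (h i)).
have sl : linear (fun x => \row_i s i x : 'rV[R]_n).
  by move=> a x y; apply/rowP=> i; rewrite !mxE linearP.
exists (mklin sl) => x; apply/rowP=> i; rewrite mxE.
exact: (projT2 (cid (h i))).
Qed.

Lemma ext_vanish_free M l n : ext_vanish M l R^o -> ext_vanish M l 'rV[R]_n.
Proof. by move=> h f; apply: ext_zero_row => i; exact: h. Qed.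

Lemma ext_vanish_scalar M l n : ext_vanish M l 'rV[R]_n.+1 -> ext_vanish M l R^o.
Proof.
move=> h f; have il : linear (fun x : R^o => const_mx x : 'rV[R]_n.+1).
  by move=> a x y; apply/rowP=> i; rewrite !mxE.
have := ext_zero_comp (entry 0) (h (lcomp (mklin il) f)).
by apply: ext_zero_ext => x /=; rewrite mxE.
Qed.

End ExtClasses.

(** * Stable isomorphisms and left approximations *)

Section StableIso.
Variable R : comNzRingType.
Implicit Types M N X Y : fpmod R.

Lemma stable_eq_free M N (f g : {linear M -> N}) : stable_eq f g ->
  exists k (a : {linear M -> 'rV[R]_k}) (b : {linear 'rV[R]_k -> N}),
    forall x, f x - g x = b (a x).
Proof.
move=> /stable_eqE[H h0 h]; have [a ha] := pres_desc_mx h0.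
exists (gens N), a, (cov N) => y; have [x <-] := cov_surj y.
by rewrite h -ha.
Qed.

Lemma stable_equivalence_comp M N X (g : {linear N -> X}) (f : {linear M -> N}) :
  stable_equivalence g -> stable_equivalence f -> stable_equivalence (lcomp g f).
Proof.
move=> [g' [g1 g2]] [f' [f1 f2]]; exists (lcomp f' g'); split.
  apply: stable_trans f1.
  apply: stable_trans (stable_compr f' (stable_compl f g1)) _; exact: stable_ext.
apply: stable_trans g2.
apply: stable_trans (stable_compr g (stable_compl g' f2)) _; exact: stable_ext.
Qed.

Lemma stable_equivalence_fmap (G : stfunctor R) M N (f : {linear M -> N}) :
  stable_equivalence f -> stable_equivalence (fmap G f).
Proof.
move=> [g [h1 h2]]; exists (fmap G g); split.
  apply: stable_trans (stable_trans (fmap_eq G h1) (fmap_id G M)).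
  exact: stable_sym (fmap_comp _ _ _).
apply: stable_trans (stable_trans (fmap_eq G h2) (fmap_id G N)).
exact: stable_sym (fmap_comp _ _ _).
Qed.

Lemma stable_equivalence_id M : stable_equivalence (lid M).
Proof. by exists (lid M); split; apply: stable_ext. Qed.

Definition stable_iso M N : Prop := exists f : {linear M -> N}, stable_equivalence f.

Lemma stable_iso_refl M : stable_iso M M.
Proof. by exists (lid M); exact: stable_equivalence_id. Qed.

Lemma stable_iso_trans M N X : stable_iso M N -> stable_iso N X -> stable_iso M X.
Proof. by move=> [f hf] [g hg]; exists (lcomp g f); apply: stable_equivalence_comp. Qed.

Lemma stable_iso_fmap (G : stfunctor R) M N : stable_iso M N -> stable_iso (G M) (G N).
Proof. by move=> [f hf]; exists (fmap G f); apply: stable_equivalence_fmap. Qed.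

Lemma stable_iso_retract M N : stable_iso M N -> stable_retract M N.
Proof. by move=> [f [g [h _]]]; exists f, g. Qed.

Definition torsionless X : Prop :=
  forall h : X, (forall n (z : {linear X -> 'rV[R]_n}), z h = 0) -> h = 0.

Lemma torsionless_retract X Y : stable_retract X Y -> torsionless Y -> torsionless X.
Proof.
move=> [i [r /stable_eq_free[k [a [b hab]]]]] tY h hz.
have := hab h; rewrite hz linear0 /= (tY (i h)); last by move=> n z; exact: (hz n (lcomp z i)).
by rewrite linear0 sub0r => /eqP; rewrite oppr_eq0 => /eqP.
Qed.

Definition left_approx X n (u : {linear X -> 'rV[R]_n}) : Prop :=
  forall k (z : {linear X -> 'rV[R]_k}),
    exists z' : {linear 'rV[R]_n -> 'rV[R]_k}, forall x, z' (u x) = z x.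

Hypothesis noethR : noetherian R.

(** The dual of [X] consists of the rows c with [c *m A^T = 0]. It is generated by the rows of some
    [E], and [E^T] then induces the approximation. *)
Lemma left_approx_ex X : exists n (u : {linear X -> 'rV[R]_n}), left_approx u.
Proof.
pose A := rel_mx X.
have [||e [E hE]] := @noetherian_submod R _ (fun c : 'rV_(gens X) => c *m A^T = 0) noethR.
- by rewrite mul0mx.
- by move=> a x y hx hy; rewrite mulmxDl -scalemxAl hx hy scaler0 addr0.
have [|u hu] := @pres_desc_mx _ _ (pres X) _ E^T.
  rewrite -[pmx _]trmxK -trmx_mul -[RHS]trmx0; congr _^T.
  by apply: row_ext => x; rewrite mulmxA mulmx0; apply/hE; exists x.
exists e, u => k z; have [Z hZ] := lin_as_mx (lcomp z (cov X)).
have AZ : A *m Z = 0.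
  by apply: row_ext => x; rewrite mulmxA -hZ /= cov_rel0 linear0 mulmx0.
have [|Y hY] := @mx_factor _ _ _ _ Z^T E.
  by move=> x; apply/hE; rewrite -mulmxA -trmx_mul AZ trmx0 mulmx0.
exists (lmx Y^T) => y; have [x <-] := cov_surj y.
by rewrite /cov hu -[LHS]/(_ *m Y^T) -mulmxA -trmx_mul -hY trmxK -hZ.
Qed.

End StableIso.

(** * Units of adjunctions at left approximations *)

Section SigmaStep.
Variable R : comNzRingType.
Implicit Types N : fpmod R.
Hypothesis noethR : noetherian R.
Variables (X Y : fpmod R) (n : nat).
Variables (u : {linear X -> 'rV[R]_n}) (q : {linear 'rV[R]_n -> Y}).
Hypotheses (ses : short_exact u q) (apu : left_approx u).

Local Notation Om := (Omega noethR).
Local Notation syz := (syz noethR).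

Lemma syzygy_compare : exists i : {linear X -> syz Y}, [/\ stable_equivalence i,
  forall N (p : {linear Y -> N}) (t : {linear 'rV[R]_n -> 'rV[R]_(gens N)})
    (w : {linear X -> syz N}),
    (forall x, cov N (t x) = p (q x)) -> (forall x, kincl (cov N) (w x) = t (u x)) ->
    stable_eq (lcomp (fmap Om p) i) w &
  forall N (p p' : {linear Y -> N}),
    stable_eq (lcomp (fmap Om p) i) (lcomp (fmap Om p') i) -> stable_eq p p'].
Proof.
have [ui qs ex] := ses; have uI := lin_inj ui.
have [qt hqt] := free_lift q (@cov_surj _ Y).
have sesY := short_exact_cov Y.
have [|i hi] := ses_lift (f := lcomp qt u) sesY.
  by move=> x; rewrite /= hqt (short_exact0 _ ses).
have {}hi x : kerval (i x) = qt (u x) by exact: hi.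
have rep N (p : {linear Y -> N}) (t : {linear 'rV[R]_n -> 'rV[R]_(gens N)})
    (w : {linear X -> syz N}) :
    (forall x, cov N (t x) = p (q x)) -> (forall x, kincl (cov N) (w x) = t (u x)) ->
    stable_eq (lcomp (fmap Om p) i) w.
  move=> ht hw.
  have [|b hb] := ses_lift (f := lsub (lcomp (lmx (lift_mx p)) qt) t) (short_exact_cov N).
    by move=> x; rewrite /= linearB lift_mxE hqt ht subrr.
  apply: (@stable_eqF _ X (syz N) _ _ n u b) => x; apply: kincl_inj.
  by rewrite hb linearB hw /= -hi; congr (_ - _); exact: syz_mapE.
have iso : @stable_equivalence R X (syz Y) i.
  have [rho hrho] := free_lift (cov Y) qs.
  have [|r hr] := ses_lift (f := lcomp rho (kincl (cov Y))) ses.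
    by move=> x; rewrite /= hrho kinclP.
  have {}hr x : u (r x) = rho (kerval x) by exact: hr.
  exists r; split.
    have [|w hw] := ses_lift (f := lsub (lid _) (lcomp rho qt)) ses.
      by move=> x; rewrite /= linearB hrho hqt subrr.
    apply: stable_sym; apply: (@stable_eqF _ X X _ _ n u w) => x; apply: uI.
    by rewrite linearB hw /= hr hi.
  have [|w hw] := ses_lift (f := lsub (lid _) (lcomp qt rho)) sesY.
    by move=> x; rewrite /= linearB hqt hrho subrr.
  apply: stable_sym.
  apply: (@stable_eqF _ (syz Y) (syz Y) _ _ _ (kincl (cov Y)) w) => x; apply: kincl_inj.
  by rewrite hw linearB /= hi hr.
exists i; split=> // N p p' h.
have [t ht] := free_lift (lcomp p q) (@cov_surj _ N).
have [t' ht'] := free_lift (lcomp p' q) (@cov_surj _ N).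
have lw (p1 : {linear Y -> N}) (t1 : {linear 'rV[R]_n -> 'rV[R]_(gens N)}) :
    (forall x, cov N (t1 x) = p1 (q x)) ->
    exists w : {linear X -> syz N}, forall x, kincl (cov N) (w x) = t1 (u x).
  move=> h1; apply: (ses_lift (f := lcomp t1 u) (short_exact_cov N)) => x.
  by rewrite /= h1 (short_exact0 _ ses) linear0.
have [w hw] := lw p t ht; have [w' hw'] := lw p' t' ht'.
have /stable_eq_free[k [a [b hab]]] : stable_eq w w'.
  apply: stable_trans (stable_sym (rep _ _ _ _ ht hw)) _.
  exact: stable_trans h (rep _ _ _ _ ht' hw').
have [a' ha'] := apu a.
have hb x : kincl (cov N) (b (a x)) = t (u x) - t' (u x) by rewrite -hab linearB hw hw'.
have [|g hg] := ses_desc (f := lsub (lsub t t') (lcomp (lcomp (kincl (cov N)) b) a')) ses.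
  by move=> x; rewrite /= ha' [kerval _]hb subrr.
apply: (@stable_eqF _ Y N _ _ _ g (cov N)) => y; have [x <-] := qs y.
by rewrite hg /= !linearB ht ht' [cov N (kerval _)]kinclP subr0.
Qed.

(** The comparison [i] from [X] to Omega Y is a universal arrow too: the unit, followed into the
    free cover, extends along [u] and induces [f : Y -> F X], stably inverse to the [g] which the
    adjunction assigns to [i]. *)
Lemma unit_approx F (adj : adjunction F Om) :
  stable_equivalence (adj_unit adj X) /\ stable_iso (F X) Y.
Proof.
have [i [[r [ri ir]] rep inj]] := syzygy_compare.
have [ui qs ex] := ses.
have [g hg] := adj_unit_ex adj i.
have [t ht] := apu (lcomp (kincl (cov (F X))) (adj_unit adj X)).
have [|f hf] := ses_desc (f := lcomp (cov (F X)) t) ses.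
  by move=> x; rewrite /= ht /= [LHS]kinclP.
have fi : stable_eq (lcomp (fmap Om f) i) (adj_unit adj X) by apply: (rep _ f t).
have fg : stable_eq (lcomp f g) (lid (F X)).
  apply: (adj_unit_inj (a := adj)).
  apply: stable_trans (stable_compl _ (fmap_comp Om _ _)) _.
  apply: stable_trans (stable_compr _ hg) _.
  apply: stable_trans fi _; apply: stable_sym.
  apply: stable_trans (stable_compl _ (fmap_id Om _)) _; exact: stable_ext.
split; last first.
  exists g, f; split=> //; apply: inj.
  apply: stable_trans (stable_compl _ (fmap_comp Om _ _)) _.
  apply: stable_trans (stable_compr _ fi) _.
  apply: stable_trans hg _; apply: stable_sym.
  apply: stable_trans (stable_compl _ (fmap_id Om _)) _; exact: stable_ext.
exists (lcomp r (fmap Om g)); split.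
  apply: stable_trans ri; exact: stable_compr _ hg.
apply: stable_trans (stable_compl _ (stable_sym fi)) _.
apply: stable_trans (stable_compr (fmap Om f) (stable_compl (fmap Om g) ir)) _.
apply: stable_trans (stable_sym (fmap_comp Om f g)) _.
apply: stable_trans (fmap_eq Om fg) _; exact: fmap_id.
Qed.

End SigmaStep.

Section Cokernel.
Variable R : comNzRingType.
Hypothesis noethR : noetherian R.

Lemma image_fp (X : fpmod R) n (u : {linear X -> 'rV[R]_n}) :
  finitely_presented (quotmod (imgp u)).
Proof.
have [U hU] := lin_as_mx (lcomp u (cov X)).
unshelve eexists; last by [].
apply: (@Presentation _ _ n (gens X) (qpi (imgp u)) U) => [y|x]; first exact: qpi_surj.
split=> [/qpiP/asboolP[y <-]|[y ->]].
  by have [z <-] := cov_surj y; exists z; rewrite -hU.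
by apply/qpiP/asboolP; exists (cov X y); rewrite -hU.
Qed.

Lemma torsionless_approx (X : fpmod R) : torsionless X ->
  exists n (u : {linear X -> 'rV[R]_n}) (Y : fpmod R) (q : {linear 'rV[R]_n -> Y}),
    short_exact u q /\ left_approx u.
Proof.
move=> tX; have [n [u au]] := left_approx_ex noethR X.
exists n, u, (FpMod (image_fp u)), (qpi (imgp u)); split=> //.
apply: short_exact_quot => x ux; apply: tX => k z.
by have [z' <-] := au _ z; rewrite ux linear0.
Qed.

Lemma adj_pow_equivalence F G (adj : adjunction F G) n (X : fpmod R) :
  (forall i, (i < n)%N -> stable_equivalence (adj_unit adj (fpow F i X))) ->
  stable_equivalence (adj_unit (adj_pow adj n) X).
Proof.
elim: n => [|n IH] h; first exact: stable_equivalence_id.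
apply: stable_equivalence_comp; last by apply: IH => i ltin; apply/h/ltnW.
exact/stable_equivalence_fmap/h.
Qed.

Lemma eta_torsionless n (X : fpmod R) :
  (forall i, (i < n)%N -> torsionless (Sigma_pow noethR i X)) ->
  stable_equivalence (eta noethR n X).
Proof.
move=> h; apply: adj_pow_equivalence => i /h/torsionless_approx[k [u [Y [q [ses au]]]]].
by have [] := unit_approx ses au (Sigma_Omega_adj noethR).
Qed.

End Cokernel.

(** * The tower of approximations of a syzygy of the residue field *)

Section ResidueField.
Variable R : comNzRingType.
Hypothesis noethR : noetherian R.
Variable m : submodClosed R^o.
Hypothesis max_m : maximal_ideal m.

Local Notation k := (residue_field noethR m).

Definition residue_one : k := qpi m (1 : R^o).

Lemma residue_gen (y : k) : exists r : R, y = r *: residue_one.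
Proof.
by have [r <-] := qpi_surj y; exists r; rewrite /residue_one -linearZ /= [_ *: _]mulr1.
Qed.

Lemma residue_eq0 (a : R) : a *: residue_one = 0 <-> (a : R^o) \in m.
Proof.
rewrite /residue_one -linearZ -[X in X \in m]mulr1; exact: qpiP.
Qed.

Lemma residue_ann (a : R) (y : k) : (a : R^o) \in m -> a *: y = 0.
Proof.
by move=> am; have [r ->] := residue_gen y; rewrite scalerA mulrC -scalerA (residue_eq0 a).2 ?scaler0.
Qed.

Lemma residue_one_neq0 : residue_one <> 0.
Proof.
move=> h; have [/negP[]] := max_m; apply/(residue_eq0 1).
by rewrite h scaler0.
Qed.

Lemma residue_hom (Y : lmodType R) (y : Y) :
  (forall a : R, (a : R^o) \in m -> a *: y = 0) ->
  exists f : {linear k -> Y}, f residue_one = y.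
Proof.
move=> h; have yl : linear (fun r : R^o => (r : R) *: y).
  by move=> a r s; rewrite scalerDl scalerA.
have [x /qpiP/h //|f hf] := lin_desc (f := mklin yl) (@qpi_surj _ _ m).
by exists f; rewrite hf /= scale1r.
Qed.

Lemma residue_inv (b : R) : (b : R^o) \notin m ->
  exists b' : R, ((1 - b' * b : R) : R^o) \in m.
Proof.
move=> bm; have [_ hmax] := max_m; apply: contrapT => hb.
(* [J] is the ideal m + R b; being proper, it would put [b] in m by maximality. *)
pose J (x : R^o) := `[< exists s : R, ((x : R) - s * b : R^o) \in m >].
have J_sub : submod_closed (J : {pred R^o}).
  split=> [|a x y]; first by apply/asboolP; exists 0; rewrite mul0r subr0 rpred0.
  move=> /asboolP[s hs] /asboolP[t ht]; apply/asboolP; exists (a * s + t).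
  rewrite mulrDl opprD addrACA -mulrA -mulrBr.
  by apply: rpredD => //; exact: (rpredZ a).
pose J' : submodClosed R^o := HB.pack J (GRing.isSubmodClosed.Build R R^o J J_sub).
have J1 : (1 : R) \notin J'.
  by apply/negP=> /asboolP[s hs]; apply: hb; exists s.
have mJ : {subset m <= J'}.
  by move=> x xm; apply/asboolP; exists 0; rewrite mul0r subr0.
move/negP: bm; apply; apply: (hmax J' J1 mJ); apply/asboolP; exists 1.
by rewrite mul1r subrr rpred0.
Qed.

End ResidueField.

Section Tower.
Variable R : comNzRingType.
Hypothesis noethR : noetherian R.
Variable m : submodClosed R^o.
Hypothesis max_m : maximal_ideal m.

Local Notation k := (residue_field noethR m).
Local Notation syz := (syz noethR).
Local Notation K l := (iter l syz k).
Local Notation one := (residue_one noethR m).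

(** Since m kills k, it kills Ext(k, Y), on which [b] therefore acts invertibly. *)
Lemma ext_zero_cancel (b : R) l (Y : lmodType R) (f : {linear K l -> Y}) :
  (b : R^o) \notin m -> ext_zero (lscale b f) -> ext_zero f.
Proof.
move=> bm hb; have [b' hb'] := residue_inv max_m bm.
have h : ext_zero (lscale (1 - b' * b) f).
  by apply: ext_zero_annihilator => x; apply: residue_ann.
apply: ext_zero_ext (ext_zero_add (ext_zero_scale b' hb) h) => x /=.
by rewrite scalerBl scale1r -scalerA addrC subrK.
Qed.

Variable d : nat.
Hypothesis van_lt : forall l, (l < d)%N -> ext_vanish noethR k l R^o.
Hypothesis nvan : ~ ext_vanish noethR k d R^o.

Let van_free l n : (l < d)%N -> ext_vanish noethR k l 'rV[R]_n.
Proof. by move=> /van_lt h; apply: ext_vanish_free. Qed.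

(* The state after i left approximations 0 -> X -> 'rV_n -> X' -> 0 starting from
   X = Omega^d k, compared with Omega^j k, j = d - i, by the map c which the
   approximations induce. The third field says that c has no section up to a unit,
   because Ext^d(X, R) = 0 <> Ext^d(k, R); the fourth one that a in m acts on X
   through c, hence kills the torsion of X. *)
Record tower i j (X : fpmod R) (c : {linear X -> K j}) : Prop := Tower {
  tower_idx : (i + j = d)%N;
  tower_inj : forall l (f : {linear K l -> X}), (l + i <= d)%N ->
    ext_zero (lcomp c f) -> ext_zero f;
  tower_sect : forall (b : R) (f : {linear K j -> X}), (b : R^o) \notin m ->
    (forall n (z : {linear X -> 'rV[R]_n}), ext_zero (lcomp z f)) ->
    ~ ext_zero (lsub (lcomp c f) (lscale b (lid (K j))));
  tower_act : forall a : R, (a : R^o) \in m -> exists e : {linear K j -> X},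
    (forall n (z : {linear X -> 'rV[R]_n}), ext_zero (lcomp z e)) /\
    exists n (s : {linear X -> 'rV[R]_n}) (t : {linear 'rV[R]_n -> X}),
      forall x, e (c x) - a *: x = t (s x);
  tower_iso : stable_iso (Sigma_pow noethR i (K d)) X }.

Lemma tower0 : tower 0 (lid (K d)).
Proof.
split=> //.
- by move=> l f _; apply: ext_zero_ext.
- move=> b f bm hf hb; apply: nvan; apply: (@ext_vanish_scalar _ _ _ _ 0) => z.
  apply: (ext_zero_cancel bm).
  apply: ext_zero_ext (ext_zero_add (hf _ z) (ext_zero_scale (-1) (ext_zero_comp z hb))).
  by move=> x /=; rewrite linearB linearZ scaleN1r addrC opprB subrK.
- move=> a am; exists (lscale a (lid (K d))); split=> [n z|].
    apply: ext_zero_ext (ext_zero_annihilator (a := a) z _) => [x|x] /=.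
      by rewrite linearZ.
    exact: residue_ann.
  by exists 0, (lzero _ _), (lzero _ _) => x /=; rewrite subrr.
- exact: stable_iso_refl.
Qed.

(** By [tower_act], m kills [h], so a map k -> X takes the value [h] at 1. Its composite with [c] is
    zero, and [tower_inj] in degree 0 applies. *)
Lemma tower_torsion0 i j (X : fpmod R) (c : {linear X -> K j}) (h : X) :
  tower i c -> (forall n (z : {linear X -> 'rV[R]_n}), z h = 0) -> c h = 0 -> h = 0.
Proof.
move=> T hz ch; have ah a : (a : R^o) \in m -> a *: h = 0.
  move=> /(tower_act T)[e [_ [n [s [t /(_ h)]]]]].
  by rewrite ch hz !linear0 sub0r => /eqP; rewrite oppr_eq0 => /eqP.
have [f hf] := residue_hom noethR ah.
rewrite -hf; apply: (tower_inj T (l := 0)) => [|y].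
  by rewrite add0n -(tower_idx T) leq_addr.
by have [r ->] := residue_gen y; rewrite /= !linearZ /= hf ch scaler0.
Qed.

Lemma tower_torsionless i j (X : fpmod R) (c : {linear X -> K j}) :
  tower i c -> torsionless X.
Proof.
move=> T h hz; have h0 := tower_torsion0 T.
(* For j > 0, Omega^j k lies in a free module, so [c h = 0]. For j = 0, a nonzero [c h] is [b] times
   the generator of k with [b] outside m, and the map k -> X through [h] contradicts
   [tower_sect]. *)
case: j => [|j] in c T h0 *; last first.
  by apply: h0 => //; apply: kincl_inj; rewrite linear0; exact: (hz _ (lcomp (kincl _) c)).
apply: contrapT => hn0; have cn0 : c h <> 0 by move=> /(h0 _ hz).
have [b hb] := residue_gen (c h).
have bm : (b : R^o) \notin m.
  by apply/negP=> /(residue_eq0 noethR) bm; apply: cn0; rewrite hb.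
have ah a : (a : R^o) \in m -> a *: h = 0.
  move=> am; apply: h0 => [n z|]; first by rewrite linearZ /= hz scaler0.
  by rewrite linearZ /=; exact: residue_ann.
have [f hf] := residue_hom noethR ah.
have hy y : exists r : R, y = r *: one /\ f y = r *: h.
  by have [r ->] := residue_gen y; exists r; rewrite linearZ /= hf.
apply: (tower_sect T (b := b) (f := f) bm) => [n z|] y /=; have [r [-> e]] := hy y.
  by rewrite e linearZ /= hz scaler0.
by rewrite e linearZ /= hb !scalerA mulrC subrr.
Qed.

Lemma towerS i j (X : fpmod R) (c : {linear X -> K j.+1}) : tower i c ->
  exists (X' : fpmod R) (c' : {linear X' -> K j}), tower i.+1 c'.
Proof.
move=> T; have [n [u [X' [q [ses au]]]]] := torsionless_approx noethR (tower_torsionless T).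
have sesK := short_exact_cov (K j).
have [ct hct] := au _ (lcomp (kincl (cov (K j))) c).
have [|c' hc'] := ses_desc (f := lcomp (cov (K j)) ct) ses.
  by move=> x; rewrite /= hct /= [LHS]kinclP.
have ijd := tower_idx T.
(* Connecting maps intertwine [c'] and [c], so questions on [X'] in degree l become questions on [X]
   in degree l + 1. *)
have cmap l (f : {linear K l -> X'}) g : connecting u q f g ->
    connecting (kincl (cov (K j))) (cov (K j)) (lcomp c' f) (lcomp c g).
  exact: connecting_map.
exists X', c'; split.
- by rewrite addSnnS.
- move=> l f; rewrite addnS => lid cf; have [g fg] := connecting_ex ses f.
  apply: (connecting_zero_inv ses fg); first by apply/van_free/(leq_trans _ lid)/leq_addr.
  apply: (tower_inj T) => //.
  by have := connecting_zero sesK (cmap _ _ _ fg) cf.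
- move=> b f bm _ cf; have [g fg] := connecting_ex ses f.
  apply: (tower_sect T (b := b) (f := g)) => // [n' z|].
    have [z' hz'] := au _ z; have [h _ hg] := fg.
    by exists (lcomp z' h) => x; rewrite /= -hz' hg.
  apply: (connecting_zero sesK) cf.
  by apply: connecting_sub; [exact: cmap|exact: connecting_scale].
(* [u e] extends to the free cover of Omega^j k as [et], and [q et] induces [e']. The map
   [et ct - a - u t s'] vanishes on the image of [u], hence induces [g] on [X'] with
   [e' c' - a = q g]. *)
- move=> a /(tower_act T)[e [he [p [s [t est]]]]].
  have [et het] : ext_zero (lcomp u e) by exact: he.
  have [|e' he'] := ses_desc (f := lcomp q et) sesK.
    by move=> x; rewrite /= -het /= (short_exact0 _ ses).
  have [s' hs'] := au _ s.
  have [|g hg] := ses_desc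
      (f := lsub (lsub (lcomp et ct) (lscale a (lid _))) (lcomp u (lcomp t s'))) ses.
    move=> x; rewrite /= hs' hct -[et _]het /= -est linearB.
    by rewrite [u (a *: x)]linearZ subrr.
  exists e'; split=> [n' z|]; first by apply: van_free; rewrite -ijd addnS ltnS leq_addl.
  exists n, g, q => x; have [_ /(_ x)[y <-] _] := ses.
  by rewrite hg hc' he' /= linearB (short_exact0 _ ses) subr0 linearB [q (a *: y)]linearZ.
- apply: stable_iso_trans (stable_iso_fmap (Sigma noethR) (tower_iso T)) _.
  by have [] := unit_approx ses au (Sigma_Omega_adj noethR).
Qed.

Lemma tower_ex i j : (i + j = d)%N -> exists (X : fpmod R) (c : {linear X -> K j}), tower i c.
Proof.
elim: i j => [|i IH] j; first by rewrite add0n => ->; exists (K d), (lid _); exact: tower0.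
by rewrite addSnnS => /IH[X [c /towerS]].
Qed.

Lemma eta_syzygy_equivalence : stable_equivalence (eta noethR d.+1 (K d)).
Proof.
apply: eta_torsionless => i; rewrite ltnS => /subnKC/tower_ex[X [c T]].
exact: torsionless_retract (stable_iso_retract (tower_iso T)) (tower_torsionless T).
Qed.

End Tower.

(** * The lower bound for syzygy retracts *)

Section RetractBound.
Variable R : comNzRingType.
Hypothesis noethR : noetherian R.
Implicit Types M N : fpmod R.

Local Notation syz := (syz noethR).

(** Dimension shifting: Ext^(l+1)(M, Omega^(l+2) N) comes from Ext^l(M, Omega^(l+1) N) by the
    connecting map, starting from Hom(M, Omega N) inside Hom(M, free) = 0. *)
Lemma ext_vanish_syz M d l N : (forall i, (i < d)%N -> ext_vanish noethR M i R^o) ->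
  (l < d)%N -> ext_vanish noethR M l (iter l.+1 syz N).
Proof.
move=> van; have vf i n : (i < d)%N -> ext_vanish noethR M i 'rV[R]_n.
  by move=> /van h; apply: ext_vanish_free.
elim: l => [|l IH] ld.
  by apply: (ext_vanish_inj (u := kincl (cov N))); [have [] := short_exact_cov N|exact: vf].
apply: (ext_vanish_sub (short_exact_cov (iter l.+1 syz N))); first exact: vf.
exact/IH/ltnW.
Qed.

(** If the identity of Omega^(n+1) M extends as [s], the complementary projection induces a section
    [g] of the cover of Omega^n M. The class of [g] lies in Ext^n(M, free) = 0, so the identity of
    Omega^n M is zero in Ext as well. *)
Lemma ext_zero_id M n : (forall i p, (i < n)%N -> ext_vanish noethR M i 'rV[R]_p) ->
  ext_zero (M := M) (l := n) (lid (iter n syz M)) -> forall x : M, x = 0.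
Proof.
elim: n => [|n IH] // van [s hs]; apply: IH => [i p /ltnW/van //|].
set L := iter n syz M in s hs *.
have [|g hg] := ses_desc (f := lsub (lid _) (lcomp (kincl (cov L)) s)) (short_exact_cov L).
  by move=> x; rewrite /= -hs subrr.
have hg0 : ext_zero (M := M) (l := n) g by exact: van.
apply: ext_zero_ext (ext_zero_comp (cov L) hg0) => y; have [x <-] := cov_surj y.
by rewrite /= hg /= linearB [cov L (kerval _)]kinclP subr0.
Qed.

Lemma syzygy_retract_bound M n N : (exists x : M, x <> 0) ->
  (forall i, (i <= n)%N -> ext_vanish noethR M i R^o) ->
  ~ stable_retract (iter n syz M) (iter n.+1 syz N).
Proof.
move=> [x0 x0n] van [i [r /stable_eq_free[k [a [b hab]]]]].
have vf l p : (l <= n)%N -> ext_vanish noethR M l 'rV[R]_p.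
  by move=> /van h; apply: ext_vanish_free.
have idn : ext_zero (M := M) (l := n) (lid (iter n syz M)).
  have hi : ext_zero (M := M) (l := n) i by apply: (@ext_vanish_syz M n.+1).
  have ha : ext_zero (M := M) (l := n) a by exact: vf.
  apply: ext_zero_ext (ext_zero_add (ext_zero_comp r hi)
                        (ext_zero_scale (-1) (ext_zero_comp b ha))) => x /=.
  by rewrite -hab /= scaleN1r opprB addrC subrK.
by apply: x0n; apply: ext_zero_id idn _ => l p /ltnW/vf.
Qed.

End RetractBound.

(** * Finiteness of the depth *)

Section KoszulCone.
Variable R : comNzRingType.

Definition is_complex (n : nat -> nat) (d : forall j, 'M[R]_(n j.+1, n j)) : Prop :=
  forall j, d j.+1 *m d j = 0.

Definition null_homotopic (n : nat -> nat) (d : forall j, 'M[R]_(n j.+1, n j)) a : Prop :=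
  exists s : forall j, 'M[R]_(n j, n j.+1),
    s 0 *m d 0 = a%:M /\ forall j, d j *m s j + s j.+1 *m d j.+1 = a%:M.

Section Cone.
Variables (n : nat -> nat) (d : forall j, 'M[R]_(n j.+1, n j)) (x : R).
Hypothesis dd : is_complex d.

(** The mapping cone of multiplication by [x]: first the base, then a copy of it shifted by one
    degree. Iteration yields Koszul complexes. *)
Definition cone_dim j := if j is j'.+1 then (n j'.+1 + n j')%N else n 0.

Definition cone_diff j : 'M[R]_(cone_dim j.+1, cone_dim j) :=
  match j with
  | 0 => col_mx (d 0) x%:M
  | j.+1 => block_mx (d j.+1) 0 x%:M (- d j)
  end.

Lemma cone_complex : is_complex cone_diff.
Proof.
case=> [|j] /=.
  by rewrite mul_block_col (dd 0) mul0mx add0r mul_scalar_mx mulNmx mul_mx_scalar subrr col_mx0.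
rewrite mulmx_block (dd j.+1) !mul0mx !mulmx0 !add0r mulmxN !mulNmx opprK (dd j).
by rewrite mul_scalar_mx mul_mx_scalar subrr block_mx0.
Qed.

Lemma cone_homotopy a : null_homotopic d a -> null_homotopic cone_diff a.
Proof.
(* The sign on the shifted copy follows that of its differential and makes the mixed blocks
   cancel. *)
move=> [s [s0 sS]]; exists (fun j => match j return 'M[R]_(cone_dim j, cone_dim j.+1) with
  | 0 => row_mx (s 0) 0 | j.+1 => block_mx (s j.+1) 0 0 (- s j) end); split=> [|[|j]] /=.
- by rewrite mul_row_col s0 mul0mx addr0.
- rewrite mul_col_row mulmx_block !mulmx0 !mul0mx mul_scalar_mx add_block_mx.
  by rewrite mulNmx mul_mx_scalar mulmxN mulNmx opprK !addr0 !add0r subrr s0 sS -scalar_mx_block.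
- rewrite !mulmx_block !mulmx0 !mul0mx !add_block_mx !mulNmx !mulmxN !opprK.
  by rewrite mul_scalar_mx mul_mx_scalar !addr0 !add0r subrr !sS -scalar_mx_block.
Qed.

Lemma cone_homotopy_self : null_homotopic cone_diff x.
Proof.
exists (fun j => match j return 'M[R]_(cone_dim j, cone_dim j.+1) with
  | 0 => row_mx 0 1%:M | j.+1 => block_mx 0 1%:M 0 0 end); split=> [|[|j]] /=.
- by rewrite mul_row_col mul0mx mul1mx add0r.
- rewrite mul_col_row mulmx_block !mulmx0 !mul0mx !mulmx1 !mul1mx add_block_mx.
  by rewrite !addr0 !add0r subrr -scalar_mx_block.
- rewrite !mulmx_block !mulmx0 !mul0mx !mulmx1 !mul1mx add_block_mx.
  by rewrite !addr0 !add0r subrr -scalar_mx_block.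
Qed.

End Cone.
End KoszulCone.

Section DepthFinite.
Variable R : comNzRingType.
Hypothesis noethR : noetherian R.
Variable m : submodClosed R^o.
Hypothesis max_m : maximal_ideal m.

Local Notation k := (residue_field noethR m).
Local Notation one := (residue_one noethR m).

Lemma koszul_ex (s : seq R) : (forall a, a \in s -> (a : R^o) \in m) ->
  exists (n : nat -> nat) (d : forall j, 'M[R]_(n j.+1, n j)) (N : nat)
    (p : {linear 'rV[R]_(n 0) -> k}),
  [/\ is_complex d, forall j, (N < j)%N -> n j = 0%N,
      forall y, exists x, p x = y, forall x, p (x *m d 0) = 0 &
      forall a, a \in s -> null_homotopic d a].
Proof.
elim: s => [|x s IH] sm.
  have pl : linear (fun x : 'rV[R]_1 => x 0 0 *: one).
    by move=> a x y; rewrite !mxE scalerDl scalerA.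
  exists (fun j => (j == 0)%N : nat), (fun j => 0), 0, (mklin pl); split=> //.
  - by move=> j; rewrite mulmx0.
  - by case.
  - by move=> y; have [r ->] := residue_gen y; exists (const_mx r); rewrite /= mxE.
  - by move=> x; rewrite mulmx0 linear0.
have [|n [d [N [p [dd dN ps pd ds]]]]] := IH.
  by move=> a sa; apply: sm; rewrite inE sa orbT.
exists (cone_dim n), (cone_diff d x), N.+1, p; split=> //.
- exact: cone_complex.
- by case=> // j; rewrite ltnS /= => Nj; rewrite !dN // ltnW.
- move=> y; rewrite /= -[y]hsubmxK mul_row_col linearD pd add0r mul_mx_scalar linearZ /=.
  by have xm := sm x (mem_head _ _); exact: (residue_ann (p (rsubmx y)) xm).
- move=> a; rewrite inE => /orP[/eqP->|/ds].
    exact: cone_homotopy_self.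
  exact: cone_homotopy.
Qed.

(* If Ext^l(k, R) = 0 for all l, then descending along the Koszul complex all its
   cokernels L have Ext^l(k, L) = 0 for all l. Its homology, which is killed by m,
   thus vanishes, H_0 = k included. *)
Lemma ext_nonvanish_ex : exists l, ~ ext_vanish noethR k l R^o.
Proof.
apply: contrapT => /forallNP van0.
have van l n : ext_vanish noethR k l 'rV[R]_n.
  by apply: ext_vanish_free; apply: contrapT (van0 l).
have [r [g hg]] := noethR m.
have [|n [d [N [p [dd dN ps pd ds]]]]] := koszul_ex (s := codom g).
  move=> a /codomP[i ->]; apply/hg; exists (fun j => (j == i)%:R).
  rewrite (bigD1 i) //= eqxx mul1r big1 ?addr0 // => j /negPf ->.
  by rewrite mul0r.
have killed (Y : lmodType R) (y : Y) : (forall l, ext_vanish noethR k l Y) ->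
    (forall i, g i *: y = 0) -> y = 0.
  move=> vY gy; have [a /hg[c ->]|f <-] := @residue_hom _ noethR m _ y.
    by rewrite scaler_suml big1 // => i _; rewrite -scalerA gy scaler0.
  exact: (vY 0%N f).
pose L j := quotmod (imgp (lmx (d j))); pose q j := qpi (imgp (lmx (d j))).
have q0 j x : q j x = 0 <-> exists y, x = y *m d j.
  split=> [/qpiP/asboolP[y <-]|[y ->]]; first by exists y.
  by apply/qpiP/asboolP; exists y.
have qZ j a x : a *: q j x = q j (a *: x) by rewrite linearZ.
have hom i : null_homotopic d (g i) by apply/ds/codom_f.
(* Descending induction on the degree [j], counted by [t] from the degrees above [N], where [L j] is
   zero. *)
have vL t : forall j, (N < j + t)%N -> forall l, ext_vanish noethR k l (L j).
  elim: t => [|t IH] j; rewrite ?addn0.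
    move=> /dN nj l f; apply: ext_zero_ext (@ext_zero0 _ noethR k l (L j)) => x.
    have [y <-] := qpi_surj (f x).
    by rewrite (_ : y = 0) ?linear0 //; apply/rowP=> i; have := ltn_ord i; rewrite {2}nj.
  rewrite addnS -addSn => /IH vj l.
  have [|de hde] := lin_desc (q := q j.+1) (f := lmx (d j)) (@qpi_surj _ _ _).
    by move=> x /q0[y ->]; rewrite /= -mulmxA dd mulmx0.
  apply: (ext_vanish_quot (u := de) (q := q j)); last 2 first.
  - exact: van.
  - exact: vj.
  split=> [y|y|x]; last 2 first.
  - exact: qpi_surj.
  - split=> [/q0[y ->]|[y ->]]; first by exists (q j.+1 y); rewrite hde.
    by have [z <-] := qpi_surj y; apply/q0; exists z; rewrite hde.
  (* The kernel of [de] is the homology in degree j + 1; each [g i] kills it by its homotopy, while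
     Hom(k, L (j + 1)) = 0. *)
  have [x <-] := qpi_surj y; rewrite -[qpi _ x]/(q j.+1 x) hde /= => xd; apply: killed => // i.
  have [s [_ /(_ j) sj]] := hom i; rewrite qZ; apply/q0.
  by exists (x *m s j.+1); rewrite -mul_mx_scalar -sj mulmxDr !mulmxA xd mul0mx add0r.
apply: (residue_one_neq0 (noethR := noethR) max_m); have [x <-] := ps one.
have /q0[y ->] : q 0%N x = 0; last exact: pd.
apply: killed => [|i]; first by apply: (vL N.+1); rewrite add0n.
have [s [s0 _]] := hom i; rewrite qZ; apply/q0; exists (x *m s 0%N).
by rewrite -mulmxA s0 mul_mx_scalar.
Qed.

End DepthFinite.

(** * Independence of Ext of the resolution *)

Section Resolutions.
Variable R : comNzRingType.
Implicit Types Z N : lmodType R.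

Lemma res_tail_aug_ex Z (P : resolution Z) :
  exists f : {linear res P 1 -> kermod (res_aug P)},
    forall x, kincl (res_aug P) (f x) = res_d P 0 x.
Proof.
apply: (ses_lift (f := res_d P 0) (short_exact_ker (@res_aug_surj _ _ P))) => x.
by apply/res_exact0; exists x.
Qed.
Definition res_tail_aug Z (P : resolution Z) := projT1 (cid (res_tail_aug_ex P)).
Lemma res_tail_augE Z (P : resolution Z) x :
  kincl (res_aug P) (res_tail_aug P x) = res_d P 0 x.
Proof. exact: (projT2 (cid (res_tail_aug_ex P))). Qed.

Definition res_tail Z (P : resolution Z) : resolution (kermod (res_aug P)).
Proof.
apply: (@Resolution _ _ (fun i => res P i.+1) (fun i => res_d P i.+1) (res_tail_aug P)).
- by move=> i; exact: res_projective.
- move=> y; have /res_exact0[x hx] := kinclP y; exists x; apply: kincl_inj.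
  by rewrite res_tail_augE -hx.
- move=> x; split=> [e|[y ->]].
    by apply/res_exact; rewrite -res_tail_augE e linear0.
  apply: kincl_inj; rewrite res_tail_augE linear0; apply/res_exact; by exists y.
- by move=> i x; exact: res_exact.
Defined.

End Resolutions.

Section ExtComparison.
Variable R : comNzRingType.
Hypothesis noethR : noetherian R.
Implicit Types (Z N J : lmodType R) (M : fpmod R).

Local Notation syz := (syz noethR).
Local Notation K M l := (iter l syz M).

(** Ext^(l+1)(M, N) = 0 reads [ext1_vanish (K M l) N], which lets an induction on the degree replace
    [M] by its syzygy. *)
Definition ext1_vanish M N : Prop := forall f : {linear syz M -> N},
  exists s : {linear 'rV[R]_(gens M) -> N}, forall x, f x = s (kincl (cov M) x).

(* The square b, beta compares the first term J of a resolution to the left of Z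
   with the corresponding term J' for M; for the resolutions of Z and M themselves
   J = J' = 0, which makes alpha a retraction of beta. *)
Lemma cocycle_extends N i : forall Z (P : resolution Z) J J' (j : {linear Z -> J}) M
    (j' : {linear M -> J'}) (alpha : {linear M -> Z}) (beta : {linear Z -> M})
    (h : {linear J -> Z}) (b : {linear J -> J'}), projective J ->
  (forall x, alpha (beta x) - x = h (j x)) -> (forall x, j' (beta x) = b (j x)) ->
  match i with
  | 0 => forall f : {linear M -> N}, exists s : {linear J' -> N}, forall x, f x = s (j' x)
  | l.+1 => ext1_vanish (K M l) N
  end ->
  forall f : {linear res P i -> N}, cocycle f ->
  match i return {linear res P i -> N} -> Prop with
  | 0 => fun f => exists s : {linear J -> N}, forall x, f x = s (j (res_aug P x))
  | l.+1 => fun f => @coboundary R Z N P l.+1 f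
  end f.
Proof.
elim: i => [|i IH] Z P J J' j M j' alpha beta h b pJ hab jb hf f cf.
  have [x /res_exact0[y ->]|fb hfb] := lin_desc (f := f) (@res_aug_surj _ _ P).
    exact: cf.
  have [s hs] := hf (lcomp fb alpha).
  exists (lsub (lcomp s b) (lcomp fb h)) => x.
  by rewrite -hfb /= -jb -hs -hab linearB opprB addrC subrK.
have sesM := short_exact_cov M.
have sesP := short_exact_ker (@res_aug_surj _ _ P).
(* [at'] and [bt] compare the covers, which become the new J and J'; [al] and [be] compare the
   kernels, with homotopy [h']. *)
have [at' hat] := free_lift (lcomp alpha (cov M)) (@res_aug_surj _ _ P).
have [bt hbt] := @res_projective _ _ P 0 _ _ (cov M) (lcomp beta (res_aug P)) (@cov_surj _ M).
have [ht hht] := pJ _ _ _ h (@res_aug_surj _ _ P).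
have [|al hal] := ses_lift (f := lcomp at' (kincl (cov M))) sesP.
  by move=> x; rewrite /= hat /= [cov M _]kinclP linear0.
have [|be hbe] := ses_lift (f := lcomp bt (kincl (res_aug P))) sesM.
  by move=> x; rewrite /= hbt /= [res_aug P _]kinclP linear0.
have [|h' hh'] := ses_lift (f := lsub (lsub (lcomp at' bt) (lid _))
                                   (lcomp ht (lcomp j (res_aug P)))) sesP.
  move=> x; rewrite /= !linearB /= hat /= hbt /= hht -hab.
  exact: subrr.
have := IH _ (res_tail P) _ _ (kincl (res_aug P)) (syz M) (kincl (cov M)) al be h' bt
  (@res_projective _ _ P 0).
case: i IH hf f cf => [|i] IH hf f cf H.
  have [x|x||x|s hs] := H _ _ _ f.
  - apply: kincl_inj; rewrite linearB hal hh' /= [kerval (be x)]hbe /=.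
    by rewrite [res_aug P (kerval _)]kinclP !linear0 addr0.
  - exact: hbe.
  - exact: hf.
  - exact: cf.
  exists s => x; by rewrite hs res_tail_augE.
have [x|x||x|s hs] := H _ _ _ f.
- apply: kincl_inj; rewrite linearB hal hh' /= [kerval (be x)]hbe /=.
  by rewrite [res_aug P (kerval _)]kinclP !linear0 addr0.
- exact: hbe.
- by rewrite -iterSr.
- exact: cf.
by exists s.
Qed.

Definition syz_resolution M : resolution M.
Proof.
apply: (@Resolution R M (fun i => 'rV[R]_(gens (K M i)))
  (fun i => lcomp (kincl (cov (K M i))) (cov (K M i.+1))) (cov M)).
- by move=> i; apply: free_projective.
- exact: cov_surj.
- move=> x; have [_ _ ex] := short_exact_cov M; split=> [/ex[y ->]|[y ->]].
    by have [z <-] := cov_surj (M := syz M) y; exists z.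
  exact: kinclP.
- move=> i x; have [_ _ ex] := short_exact_cov (K M i.+1); split=> [e|[y ->]].
    have /ex[y ->] : cov (K M i.+1) x = 0 by apply: kincl_inj; rewrite linear0.
    by have [z <-] := cov_surj (M := K M i.+2) y; exists z.
  by rewrite /= [cov _ (kerval _)]kinclP.
Defined.

(** From left to right, [cocycle_extends] with J = J' = 0 carries vanishing along the syzygies over
    to any resolution. Conversely, a nonzero class composed with the cover is a cocycle on
    [syz_resolution]. *)
Lemma Ext_nonzeroE M N i : Ext_nonzero i M N <-> ~ ext_vanish noethR M i N.
Proof.
split=> [[P [f [cf ncf]]] van|/existsNP[f nf]].
  apply: ncf.
  have := @cocycle_extends N i M P 'rV[R]_0 'rV[R]_0 (lzero _ _) M (lzero _ _)
    (lid _) (lid _) (lzero _ _) (lzero _ _) (@free_projective _ _).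
  case: i f cf van => [|i] f cf van H; last first.
    by apply: H => // x /=; rewrite subrr.
  have [x|//|g|s hs] := H _ _ _ f cf.
  - by rewrite /= subrr.
  - by exists (lzero _ _) => x; exact: van.
  - by move=> x; rewrite hs linear0.
exists (syz_resolution M), (lcomp f (cov (K M i))); split.
  by move=> x; rewrite /= [cov _ _]kinclP linear0.
case: i f nf => [|i] f nf H; apply: nf.
  by move=> y; have [x <-] := cov_surj (M := M) y; exact: H.
have [g hg] := H; exists g => y; have [x <-] := cov_surj (M := K M i.+1) y.
exact: hg.
Qed.

End ExtComparison.

(** * Projective dimension *)

Section LocalRing.
Variable R : comNzRingType.
Variable m : submodClosed R^o.
Hypothesis localR : local_ring m.

(** By Zorn's lemma a non-unit lies in a maximal ideal, which is m by locality. *)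
Lemma local_unit (a : R) : (a : R^o) \notin m -> exists b : R, b * a = 1.
Proof.
move=> am; apply: contrapT => /forallNP na.
pose T := {J : R -> bool | [/\ submod_closed (J : {pred R^o}), ~~ J 1 & J a]}.
pose J0 (x : R) := `[< exists b : R, x = b * a >].
have J0P : [/\ submod_closed (J0 : {pred R^o}), ~~ J0 1 & J0 a].
  split; last by apply/asboolP; exists 1; rewrite mul1r.
    split=> [|c x y]; first by apply/asboolP; exists 0; rewrite mul0r.
    move=> /asboolP[s ->] /asboolP[t ->]; apply/asboolP; exists (c * s + t).
    by rewrite mulrDl -mulrA.
  by apply/negP=> /asboolP[b hb]; apply: (na b).
pose le (I J : T) := `[< forall x, sval I x -> sval J x >].
have [t||A Atot|[J [Jsub J1 Ja]] Jmax] := @ZL_preorder T (exist _ J0 J0P) le.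
- exact/asboolP.
- by move=> I J L /asboolP IJ /asboolP JL; apply/asboolP=> x /IJ/JL.
(* The empty chain is bounded by R a, any other by its union. *)
- have [[I0 AI0]|A0] := pselect (exists I, A I); last first.
    by exists (exist _ J0 J0P) => s As; case: A0; exists s.
  pose U (x : R) := `[< exists2 I : T, A I & sval I x >].
  have UP : [/\ submod_closed (U : {pred R^o}), ~~ U 1 & U a].
    split; last by apply/asboolP; exists I0 => //; case: (svalP I0).
      split=> [|c x y]; first by apply/asboolP; exists I0 => //; have [[]] := svalP I0.
      move=> /asboolP[I AI xI] /asboolP[J AJ yJ]; apply/asboolP.
      have [/asboolP IJ|/asboolP JI] := Atot _ _ AI AJ.
        by exists J => //; have [[_ +] _ _] := svalP J; apply=> //; exact: IJ.
      by exists I => //; have [[_ +] _ _] := svalP I; apply=> //; exact: JI.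
    by apply/negP=> /asboolP[I _]; apply/negP; case: (svalP I).
  by exists (exist _ U UP) => I AI; apply/asboolP=> x xI; apply/asboolP; exists I.
pose J' : submodClosed R^o :=
  HB.pack (J : {pred R^o}) (GRing.isSubmodClosed.Build R R^o J Jsub).
have Jmax' : maximal_ideal J'.
  split=> [|L L1 JL]; first exact: J1.
  have LP : [/\ submod_closed (L : {pred R^o}), ~~ (L : {pred R^o}) 1 & (L : {pred R^o}) a].
    split=> //; last exact: JL.
    by split=> [|c x y xL yL]; [exact: rpred0|apply: rpredD => //; exact: rpredZ].
  have /asboolP h := Jmax (exist _ (L : {pred R^o}) LP) (introT (asboolP _) JL).
  by move=> x; exact: h.
by move/negP: am; apply; rewrite -(localR.2 _ Jmax').
Qed.

(** With the least number of generators, no relation has a unit among its entries, since the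
    generator in that position could be dropped. *)
Lemma minimal_cover (Y : lmodType R) n (q0 : {linear 'rV[R]_n -> Y}) :
  (forall y, exists x, q0 x = y) ->
  exists g (q : {linear 'rV[R]_g -> Y}), (forall y, exists x, q x = y) /\
    forall x, q x = 0 -> forall i, (x 0 i : R^o) \in m.
Proof.
move=> q0s; pose P g := `[< exists q : {linear 'rV[R]_g -> Y}, forall y, exists x, q x = y >].
have exP : exists g, P g by exists n; apply/asboolP; exists q0.
have [g /asboolP[q qs] gmin] := ex_minnP exP; exists g, q; split=> // x qx i.
apply: contrapT => /negP/local_unit[b hb].
case: g => [|g] in q qs gmin x qx i hb *; first by case: i hb => ? ?.
suff /gmin : P g by rewrite ltnn.
apply/asboolP; pose E : 'M[R]_(g, g.+1) := \matrix_j delta_mx 0 (lift i j).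
exists (lcomp q (lmx E)) => y; have [z <-] := qs y.
(* [x] is a relation whose entry at [i] is inverse to [b], so [z'] has the image of [z] and entry 0
   at [i]. *)
pose z' := z - (z 0 i * b) *: x.
have qz' : q z' = q z by rewrite linearB linearZ qx /= scaler0 subr0.
exists (\row_j z' 0 (lift i j)); rewrite -qz' /=; congr (q _); apply/rowP=> j.
rewrite mulmx_sum_row summxE; case: (unliftP i j) => [j' ->|->].
  rewrite (bigD1 j') //= rowK !mxE !eqxx mulr1 big1 ?addr0 // => l /negPf lj.
  by rewrite rowK !mxE (inj_eq (@lift_inj _ i)) eq_sym lj mulr0.
rewrite big1 => [|l _]; last by rewrite rowK !mxE (negPf (neq_lift i l)) mulr0.
by rewrite !mxE -mulrA hb mulr1 subrr.
Qed.

End LocalRing.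

Section ProjectiveDimension.
Variable R : comNzRingType.
Implicit Types (U V W Z F Q : lmodType R).

Definition pd_le n Z : Prop :=
  exists P : resolution Z, forall i, (n < i)%N -> forall x : res P i, x = 0.

Lemma pd_le_leq n n' Z : (n <= n')%N -> pd_le n Z -> pd_le n' Z.
Proof. by move=> le [P h]; exists P => i lt; apply/h/(leq_ltn_trans le). Qed.

Definition cons_mod F (E : nat -> lmodType R) i : lmodType R :=
  if i is i'.+1 then E i' else F.

Definition cons_diff U F (u : {linear U -> F}) (P : resolution U) i :
    {linear cons_mod F (res P) i.+1 -> cons_mod F (res P) i} :=
  match i return {linear cons_mod F (res P) i.+1 -> cons_mod F (res P) i} with
  | 0 => lcomp u (res_aug P)
  | i'.+1 => res_d P i'
  end.

Definition res_cons U F V (u : {linear U -> F}) (q : {linear F -> V})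
  (ses : short_exact u q) (pF : projective F) (P : resolution U) : resolution V.
Proof.
apply: (@Resolution R V (cons_mod F (res P)) (cons_diff u P) q).
- by case=> [|i] //; exact: res_projective.
- by have [] := ses.
- move=> x; have [_ _ ex] := ses; split=> [/ex[y ->]|[y ->]]; last exact: short_exact0 ses.
  by have [z <-] := res_aug_surj P y; exists z.
- case=> [|i] x; last exact: res_exact.
  split=> [e|/res_exact0 e]; last by rewrite /= e linear0.
  by apply/res_exact0; have [ui _ _] := ses; exact: ui.
Defined.

Lemma pd_leS n U F V (u : {linear U -> F}) (q : {linear F -> V}) :
  short_exact u q -> projective F -> pd_le n U -> pd_le n.+1 V.
Proof. by move=> ses pF [P h]; exists (res_cons ses pF P); case=> // i; exact: h. Qed.

Lemma pd_le0 Z : projective Z -> pd_le 0 Z.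
Proof.
move=> pZ; have e0 (x : 'rV[R]_0) : x = 0 by apply/rowP; case.
have [P hP] : exists P : resolution 'rV[R]_0, forall i (x : res P i), x = 0.
  unshelve eexists; first apply: (@Resolution R 'rV[R]_0 (fun=> 'rV[R]_0)
    (fun=> lzero _ _) (lzero _ _)) => //.
  - by move=> _; exact: free_projective.
  - by move=> y; exists 0; rewrite (e0 y).
  - by move=> x; split=> _ //; exists 0.
  - by move=> _ x; split=> _ //; exists 0.
  by move=> i; exact: e0.
have ses : short_exact (lzero 'rV[R]_0 Z) (lid Z).
  split=> [x _|y|x]; [exact: e0|by exists y|].
  by split=> [e|[y ->]//]; exists 0; exact: e.
by exists (res_cons ses pZ P); case=> // i _; exact: hP.
Qed.

(** A certificate for projective dimension above n along arbitrary short exact sequences, so that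
    minimal covers and dualized resolutions both serve. *)
Fixpoint nonprojective_syzygy n V : Prop :=
  if n is n'.+1 then
    exists U F (u : {linear U -> F}) (q : {linear F -> V}),
      [/\ short_exact u q, projective F & nonprojective_syzygy n' U]
  else ~ projective V.

(* V is not assumed to be the module Z that P resolves, but only a retract of Z up
   to a map through a projective: this is all that a comparison of syzygies
   of resolutions gives. *)
Lemma syzygy_projective n : forall Z (P : resolution Z) V Q (alpha : {linear V -> Z})
    (beta : {linear Z -> V}) (s : {linear V -> Q}) (t : {linear Q -> V}),
  (forall i, (n < i)%N -> forall x : res P i, x = 0) -> projective Q ->
  (forall x, beta (alpha x) - x = t (s x)) -> ~ nonprojective_syzygy n V.
Proof.
elim: n => [|n IH] Z P V Q alpha beta s t P0 pQ hab /=.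
  apply=> X Y p f ps.
  have [l hl] := @res_projective _ _ P 0 _ _ p (lcomp f (lcomp beta (res_aug P))) ps.
  have [x /res_exact0[y ->]|l' hl'] := lin_desc (f := l) (@res_aug_surj _ _ P).
    by rewrite (P0 1%N isT y) !linear0.
  have [l2 hl2] := pQ _ _ p (lcomp f t) ps.
  exists (lsub (lcomp l' alpha) (lcomp l2 s)) => v.
  have [x hx] := res_aug_surj P (alpha v).
  by rewrite /= linearB -hx hl' hl hl2 /= -hab hx linearB opprB addrC subrK.
move=> [U [F [u [q [ses pF nU]]]]].
have [ui qs ex] := ses.
have sesP := short_exact_ker (@res_aug_surj _ _ P).
have [at' hat] := pF _ _ _ (lcomp alpha q) (@res_aug_surj _ _ P).
have [bt hbt] := @res_projective _ _ P 0 _ _ q (lcomp beta (res_aug P)) qs.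
have [tt htt] := pQ _ _ q t qs.
have [|al hal] := ses_lift (f := lcomp at' u) sesP.
  by move=> x; rewrite /= hat /= (short_exact0 _ ses) linear0.
have [|be hbe] := ses_lift (f := lcomp bt (kincl (res_aug P))) ses.
  by move=> x; rewrite /= hbt /= [res_aug P _]kinclP linear0.
have [|h hh] := ses_lift (f := lsub (lsub (lcomp bt at') (lid F)) (lcomp tt (lcomp s q))) ses.
  move=> x; rewrite /= !linearB /= hbt /= hat /= htt -hab.
  exact: subrr.
apply: (IH _ (res_tail P) U F al be u h) nU => // [i ni x|x].
  exact: (P0 i.+1).
apply: (lin_inj ui); rewrite linearB hbe hh /= [kerval (al x)]hal /=.
by rewrite (short_exact0 _ ses) !linear0 addr0.
Qed.

Lemma nonprojective_syzygy_pd n V : nonprojective_syzygy n V -> ~ pd_le n V.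
Proof.
move=> h [P hP]; apply: (syzygy_projective (P := P) (Q := 'rV[R]_0) (alpha := lid V)
  (beta := lid V) (s := lzero _ _) (t := lzero _ _) hP _ _ h) => [|x].
  exact: free_projective.
by rewrite /= subrr.
Qed.

Hypothesis noethR : noetherian R.
Local Notation syz := (syz noethR).

Lemma pd_le_iter_syz i j (M : fpmod R) : pd_le j (iter i syz M) -> pd_le (i + j) M.
Proof.
elim: i j => [|i IH] j // h; rewrite addSnnS; apply: IH.
by apply: pd_leS h; [exact: short_exact_cov|exact: free_projective].
Qed.

Lemma nonprojective_iter_syz i j (M : fpmod R) :
  nonprojective_syzygy j (iter i syz M) -> nonprojective_syzygy (i + j) M.
Proof.
elim: i j => [|i IH] j // h; rewrite addSnnS; apply: IH.
exists (syz (iter i syz M)), 'rV[R]_(gens (iter i syz M)), (kincl (cov _)), (cov _).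
by split=> //; [exact: short_exact_cov|exact: free_projective].
Qed.

End ProjectiveDimension.

(** * The finitistic dimension *)

Section FinitisticDimension.
Variable R : comNzRingType.
Hypothesis noethR : noetherian R.
Variable m : submodClosed R^o.
Hypothesis localR : local_ring m.

Local Notation k := (residue_field noethR m).
Local Notation one := (residue_one noethR m).
Local Notation syz := (syz noethR).
Local Notation K l := (iter l syz k).

Variable d : nat.
Hypothesis van_lt : forall l, (l < d)%N -> ext_vanish noethR k l R^o.

Fact rank_one_linear (V W : lmodType R) (z : {linear V -> R^o}) (p : W) :
  linear (fun x => (z x : R) *: p).
Proof. by move=> a x y; rewrite linearP scalerDl scalerA. Qed.
Definition rank_one (V W : lmodType R) (z : {linear V -> R^o}) (p : W) :
  {linear V -> W} := mklin (rank_one_linear z p).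

Section UpperBound.
Hypothesis nvan : ~ ext_vanish noethR k d R^o.

(* Let x be an element of a minimal generating set of the kernel P <> 0 and s a section
   of the corresponding cover of P; some entry b of s x is 1 modulo m. For a non-zero
   class z in Ext^d(k, R) the class z x in Ext^d(k, P) is not zero, for b z is not, and
   it dies in Ext^d(k, 'rV_g) since x has entries in m: it comes from Ext^(d-1)(k, Y). *)
Lemma free_cover_projective g (Y : lmodType R) (q : {linear 'rV[R]_g -> Y}) :
  (forall y, exists x, q x = y) -> (forall x, q x = 0 -> forall i, (x 0 i : R^o) \in m) ->
  projective (kermod q) -> (forall l, d = l.+1 -> ext_vanish noethR k l Y) ->
  projective Y.
Proof.
move=> qs qm pP vY; have max_m := localR.1.
have ses := short_exact_ker qs.
have [pr _] := ker_fp q noethR.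
have [p [w [ws wm]]] := minimal_cover localR (@pcov_surj _ _ pr).
have [s hs] := pP _ _ w (lid _) ws.
case: p => [|p] in w ws wm s hs *.
  have P0 (x : kermod q) : x = 0.
    by have [y <-] := ws x; rewrite (_ : y = 0) ?linear0 //; apply/rowP; case.
  move=> X Z r f rs; have [h hh] := free_lift (lcomp f q) rs.
  have [|h' hh'] := ses_desc (f := h) ses; first by move=> x; rewrite (P0 x) !linear0.
  by exists h' => y; have [x <-] := qs y; rewrite hh' hh.
have /existsNP[z nz] := nvan.
pose x := w (delta_mx 0 0); pose b := s x 0 0.
have bm : (b : R^o) \notin m.
  have : ((b - 1 : R) : R^o) \in m.
    have := wm (s x - delta_mx 0 0); rewrite linearB hs subrr => /(_ erefl 0).
    by rewrite !mxE.
  move=> bm1; apply/negP=> bm; have [/negP[]] := max_m.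
  have -> : (1 : R^o) = -1 *: ((b - 1 : R) : R^o) + b by rewrite scaleN1r opprB subrK.
  by apply: rpredD => //; exact: rpredZ.
pose f : {linear K d -> kermod q} := rank_one z x.
have f0 : ext_zero (M := k) (l := d) (lcomp (kincl q) f).
  apply: ext_zero_row => i; pose a := kincl q x 0 i.
  have am : (a : R^o) \in m by apply: qm; exact: kinclP.
  apply: ext_zero_ext (ext_zero_annihilator (a := a) z _) => y.
    by rewrite /= !mxE mulrC.
  exact: residue_ann.
have {}f0 : ext_zero (M := k) (l := d) f.
  case: d z nz vY f f0 => [|l] z nz vY f f0.
    by move=> y; apply: kincl_inj; rewrite linear0; exact: f0.
  have [h hf] := connecting_inv ses f0.
  exact: (connecting_zero ses hf (vY l erefl h)).
case: nz; apply: (ext_zero_cancel max_m bm).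
have h0 := ext_zero_comp (lcomp (entry R 0) s) f0.
apply: ext_zero_ext h0 => y.
by rewrite /= linearZ /= !mxE mulrC.
Qed.

(** If n + 1 > d were the projective dimension, Omega^n M would not be projective, but the kernel of
    its minimal cover would be. As d <= n, Ext^(d-1)(k, Omega^n M) = 0 for d > 0, so
    [free_cover_projective] gives a contradiction. *)
Lemma projdim_le_depth (M : fpmod R) n : pd_le n M ->
  (forall n', pd_le n' M -> (n <= n')%N) -> (n <= d)%N.
Proof.
move=> Mn nmin; rewrite leqNgt; apply/negP; case: n => // n in Mn nmin *; rewrite ltnS => dn.
pose Y := iter n syz M.
have nY : ~ projective Y.
  by move/pd_le0/pd_le_iter_syz; rewrite addn0 => /nmin; rewrite ltnn.
have [p _] := fp_prop Y; have [g [q [qs qm]]] := minimal_cover localR (pcov_surj p).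
have pP : projective (kermod q).
  apply: contrapT => nP; apply: nonprojective_syzygy_pd Mn.
  rewrite -addn1; apply: (nonprojective_iter_syz (noethR := noethR)).
  exists (kermod q), 'rV[R]_g, (kincl q), q; split=> //; first exact: short_exact_ker.
  exact: free_projective.
apply/nY/(free_cover_projective qs qm pP) => l dl.
rewrite /Y -(subnKC dn) iterD {1}dl.
have ld : (l < d)%N by rewrite dl.
exact: (ext_vanish_syz (N := iter (n - d) syz M) van_lt ld).
Qed.

End UpperBound.

Section LowerBound.

Local Notation D j := (syz_mx noethR (K j))^T.

(* The cokernel of the dual of the differential from degree j to degree j - 1 in
   syz_resolution k. *)
Definition dual_syz j : lmodType R :=
  if j is j'.+1 then quotmod (imgp (lmx (D j'))) else 'rV[R]_(gens k).

Definition dual_pi j : {linear 'rV[R]_(gens (K j)) -> dual_syz j} :=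
  match j return {linear 'rV[R]_(gens (K j)) -> dual_syz j} with
  | 0 => lid _
  | j'.+1 => qpi (imgp (lmx (D j')))
  end.

Lemma dual_pi_surj j y : exists x, dual_pi j x = y.
Proof. by case: j y => [|j] y; [exists y|exact: qpi_surj]. Qed.

Lemma dual_pi_eq0 j x : dual_pi j.+1 x = 0 <-> exists y, x = y *m D j.
Proof.
split=> [/qpiP/asboolP[y <-]|[y ->]]; first by exists y.
by apply/qpiP/asboolP; exists y.
Qed.

(** A functional [x] killed by [D j] induces [f] on Omega^j k. As Ext^j(k, R) = 0, [f] is zero if j
    = 0 and otherwise extends to the preceding free module. *)
Lemma dual_pi_exact j x : (j < d)%N -> x *m D j = 0 -> dual_pi j x = 0.
Proof.
move=> jd xD.
have [|f hf] := ses_desc (f := dual_free x) (short_exact_cov (K j)).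
  move=> w; have [v <-] := cov_surj (M := K j.+1) w.
  rewrite -syz_mxE /= -mulmxA -[syz_mx _ _]trmxK -trmx_mul xD.
  by rewrite trmx0 mulmx0 mxE.
case: j x xD f hf jd => [|j] x xD f hf jd.
  apply/rowP=> i; have := hf (delta_mx 0 i).
  by rewrite (van_lt jd f) /= -rowE !mxE.
have [s hs] := van_lt jd f; have [c [hc _]] := dual_free_bij s.
apply/dual_pi_eq0; exists c; apply/rowP=> i; have := hf (delta_mx 0 i).
rewrite hs -hc -[kincl _ _]syz_mxE dual_free_comp /=.
by rewrite -!rowE !mxE.
Qed.

Lemma dual_syz_exact j : (j < d)%N ->
  exists de : {linear dual_syz j -> 'rV[R]_(gens (K j.+1))},
    short_exact de (dual_pi j.+1) /\ forall x, de (dual_pi j x) = x *m D j.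
Proof.
move=> jd; have [|de hde] := lin_desc (f := lmx (D j)) (@dual_pi_surj j).
  case: j jd => [|j] jd x; first by move=> x0; rewrite [x]x0 linear0.
  move=> /dual_pi_eq0[y ->]; rewrite /= -mulmxA -trmx_mul.
  have -> : syz_mx noethR (K j.+1) *m syz_mx noethR (K j) = 0.
    apply: row_ext => v; rewrite mulmxA (@syz_mxE _ noethR (K j)).
    by rewrite [cov _ _](@syz_mx_cov _ noethR (K j.+1)) linear0 mulmx0.
  by rewrite trmx0 mulmx0.
exists de; split=> //; split=> [y|y|x].
- by have [x <-] := dual_pi_surj y; rewrite hde; exact: dual_pi_exact.
- exact: dual_pi_surj.
- split=> [/dual_pi_eq0[y ->]|[y ->]]; first by exists (dual_pi j y); rewrite hde.
  by have [z <-] := dual_pi_surj y; apply/dual_pi_eq0; exists z; rewrite hde.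
Qed.

Lemma dual_syz_pd_le j : (j <= d)%N -> pd_le j (dual_syz j).
Proof.
elim: j => [|j IH] jd; first exact/pd_le0/free_projective.
have [de [ses _]] := dual_syz_exact jd.
by apply: pd_leS ses _ (IH (ltnW jd)); exact: free_projective.
Qed.

(** The dual sequences lead back to [dual_syz 1]. Were it projective, the first dual differential
    would have a retraction; transposed, this makes the relations fill the free cover of k, and k =
    0. *)
Lemma dual_syz_nonprojective j : (j < d)%N -> nonprojective_syzygy j (dual_syz j.+1).
Proof.
elim: j => [|j IH] jd; have [de [ses hde]] := dual_syz_exact jd; last first.
  exists (dual_syz j.+1), 'rV[R]_(gens (K j.+2)), de, (dual_pi j.+2); split=> //.
    exact: free_projective.
  exact/IH/ltnW.
move=> pQ; have [di _ _] := ses.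
have [s hs] := pQ _ _ (dual_pi 1) (lid _) (@dual_pi_surj 1).
have [|r hr] := ses_lift (f := lsub (lid _) (lcomp s (dual_pi 1))) ses.
  move=> x; rewrite -[LHS]/(dual_pi 1 (x - s (dual_pi 1 x))) linearB hs.
  exact: subrr.
have [S hS] := lin_as_mx r.
have DS : S^T *m syz_mx noethR k = 1%:M.
  rewrite -[X in _ *m X]trmxK -trmx_mul -[RHS]trmx1; congr _^T.
  apply: row_ext => x; rewrite mulmxA mulmx1 -hS -(hde x).
  apply: (lin_inj di); rewrite hr -[LHS]/(de x - s (dual_pi 1 (de x))).
  by rewrite (short_exact0 _ ses) linear0 subr0.
apply: (residue_one_neq0 (noethR := noethR) localR.1).
have [x <-] := cov_surj (residue_one noethR m).
by rewrite -[x]mulmx1 -DS mulmxA syz_mx_cov.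
Qed.

Lemma dual_syz_fp j : finitely_presented (dual_syz j).
Proof.
case: j => [|j]; first exact: free_fp.
exact: (image_fp (X := free_fpmod R (gens (K j))) (lmx (D j))).
Qed.

Lemma pd_exact : exists M : fpmod R, pd_le d M /\ forall n, pd_le n M -> (d <= n)%N.
Proof.
exists (FpMod (dual_syz_fp d)); split=> [|n]; first exact: dual_syz_pd_le.
have nd := dual_syz_nonprojective; case: d nd => // d' nd hn.
rewrite ltnNge; apply/negP => nd'.
exact: nonprojective_syzygy_pd (nd d' (ltnSn _)) (pd_le_leq nd' hn).
Qed.

End LowerBound.
End FinitisticDimension.

(** * Comparison of the invariants *)

Lemma inf_nat_Some (S : nat -> Prop) n :
  inf_nat S = Some n <-> S n /\ forall p, S p -> (n <= p)%N.
Proof.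
rewrite /inf_nat; case: pselect => [e|ne]; last first.
  by split=> // -[Sn _]; case: ne; exists n; apply/asboolP.
case: ex_minnP => p /asboolP Sp pmin; split=> [[<-]|[Sn nmin]].
  by split=> // q Sq; apply/pmin/asboolP.
congr Some; apply/eqP; rewrite eqn_leq nmin // andbT; exact/pmin/asboolP.
Qed.

Lemma depth_Some (R : comNzRingType) (noethR : noetherian R) (m : submodClosed R^o) d :
  depth noethR m = Some d <->
  ~ ext_vanish noethR (residue_field noethR m) d R^o /\
  forall l, (l < d)%N -> ext_vanish noethR (residue_field noethR m) l R^o.
Proof.
rewrite /depth inf_nat_Some; split=> -[/(Ext_nonzeroE noethR) nv dmin]; split=> //.
  move=> l ld; apply: contrapT => /(Ext_nonzeroE noethR)/dmin.
  by rewrite leqNgt ld.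
by move=> l /(Ext_nonzeroE noethR) nl; rewrite leqNgt; apply/negP=> /dmin.
Qed.

Theorem theorem3p1 (R : comNzRingType) (noethR : noetherian R)
    (m : submodClosed R^o) (localR : local_ring m) :
  (depth noethR m = findim R /\ findim R = dell_ring noethR m) /\
  (forall d : nat, depth noethR m = Some d ->
    stable_equivalence
      (eta noethR d.+1 (Omega_pow noethR d (residue_field noethR m))) /\
    forall n : nat,
      stable_equivalence
        (eta noethR n.+1 (Omega_pow noethR n (residue_field noethR m))) ->
      (d <= n)%N).
Proof.
set k := residue_field noethR m.
have k1 : exists x : k, x <> 0.
  by exists (residue_one noethR m); exact: residue_one_neq0 localR.1.
(* An invertible unit exhibits a retract as in [dell], so one lower bound for retracts serves both
   minimality claims. *)
have eta_retract n : stable_equivalence (eta noethR n.+1 (Omega_pow noethR n k)) ->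
    exists N, stable_retract (Omega_pow noethR n k) (Omega_pow noethR n.+1 N).
  move=> [g [h _]]; exists (Sigma_pow noethR n.+1 (Omega_pow noethR n k)).
  by exists (eta noethR n.+1 (Omega_pow noethR n k)), g.
have dE d : depth noethR m = Some d ->
    stable_equivalence (eta noethR d.+1 (Omega_pow noethR d k)) /\
    forall n N, stable_retract (Omega_pow noethR n k) (Omega_pow noethR n.+1 N) ->
      (d <= n)%N.
  move=> /depth_Some[nv van]; split.
    by rewrite /Omega_pow fpowrE; exact: (eta_syzygy_equivalence localR.1 van nv).
  move=> n N; rewrite /Omega_pow !fpowrE leqNgt => nN; apply/negP=> nd.
  apply: syzygy_retract_bound nN => // i /leq_ltn_trans; move=> /(_ _ nd); exact: van.
split; last first.
  by move=> d /dE[ed dmin]; split=> // n /eta_retract[N]; exact: dmin.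
have [d hd] : exists d, depth noethR m = Some d.
  have [l nl] := ext_nonvanish_ex noethR localR.1.
  have ex : exists l, `[< ~ ext_vanish noethR k l R^o >] by exists l; apply/asboolP.
  have [d /asboolP nd dmin] := ex_minnP ex; exists d; apply/depth_Some; split=> // i id.
  apply: contrapT => /asboolP/dmin; by rewrite leqNgt id.
have [nv van] := (depth_Some noethR m d).1 hd.
have pdE (M : fpmod R) n : projdim M = Some n <->
    pd_le n M /\ forall p, pd_le p M -> (n <= p)%N by exact: inf_nat_Some.
have -> : findim R = Some d.
  apply/inf_nat_Some; split=> [n [M /pdE[Mn nmin]]|n dn].
    exact: (projdim_le_depth localR van nv Mn nmin).
  by have [M Md] := pd_exact localR van; apply: dn; exists M; apply/pdE.
rewrite hd; split=> //; apply/esym/inf_nat_Some.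
have [ed dmin] := dE d hd; split; first exact: eta_retract.
by move=> n [N]; exact: dmin.
Qed.
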